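(* Let $\mathcal{S}=\{F_t\}_{t\ge0}$ be a one-parameter continuous semigroup of $\rho$-nonexpansive self-mappings of the open unit ball $\mathbb{B}$ of a complex Hilbert space $\mathcal{H}$, generated by $f:\mathbb{B}\to\mathcal{H}$. Assume that $f$ is null point free in $\mathbb{B}$ (that is, $\mathcal{S}$ has no stationary point in $\mathbb{B}$). Then there is a unique point $\tau\in\partial\mathbb{B}$ such that $$d_\tau(F_t(x))\le\exp(-t\alpha)\, d_\tau(x)\quad\text{for all }x\in\mathbb{B},\ t\ge0,$$ for some $\alpha\ge0$, and there is a continuous curve $\{x(r):0\le r<1\}\subset\mathbb{B}$ ending at $\tau$ (that is, $x(r)\to\tau$ as $r\to1^-$) for which $$\lim_{r\to1^-}f(x(r))=0.$$ Conversely (for a semigroup $\mathcal{S}$ and generator $f$ as in the first sentence, without assuming that $f$ is null point free), if for some point $\tau\in\partial\mathbb{B}$ the radial limit $\lim_{r\to1^-}f(r\tau)$ equals $0$ and the radial limit $$\alpha:=\lim_{r\to1^-}\operatorname{Re}\frac{\langle f(r\tau),\tau\rangle}{r-1}$$ exists and is positive, then for each $t>0$ the mapping $F_t$ has no fixed point in $\mathbb{B}$.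
   Context: $\mathcal{H}$ is a complex Hilbert space (not necessarily finite-dimensional) with inner product $\langle\cdot,\cdot\rangle$ (linear in the first argument) and norm $\|\cdot\|$; $\mathbb{B}=\{x\in\mathcal{H}:\|x\|<1\}$ and $\partial\mathbb{B}$ is its boundary, the unit sphere. The hyperbolic metric on $\mathbb{B}$ is $$\rho(x,y)=\tanh^{-1}\sqrt{1-\sigma(x,y)},\qquad \sigma(x,y)=\frac{(1-\|x\|^2)(1-\|y\|^2)}{|1-\langle x,y\rangle|^2},\quad x,y\in\mathbb{B}.$$ A self-mapping $F:\mathbb{B}\to\mathbb{B}$ is $\rho$-nonexpansive if $\rho(F(x),F(y))\le\rho(x,y)$ for all $x,y\in\mathbb{B}$. A family $\{F_t\}_{t\ge0}$ of self-mappings of $\mathbb{B}$ is a one-parameter continuous semigroup (flow) on $\mathbb{B}$ if $F_{t+s}=F_t\circ F_s$ for all $t,s\ge0$ and $\lim_{t\to0^+}F_t(x)=x$ in norm for each $x\in\mathbb{B}$. It is generated by $f:\mathbb{B}\to\mathcal{H}$ (and $f$ is its infinitesimal generator) if for each $x\in\mathbb{B}$ the strong (norm) limit $$f(x)=\lim_{t\to0^+}\frac1t\bigl(x-F_t(x)\bigr)$$ exists. A null point of $f$ in $\mathbb{B}$ is a point $x\in\mathbb{B}$ with $f(x)=0$; a stationary point of the semigroup is a point $x\in\mathbb{B}$ with $F_t(x)=x$ for all $t\ge0$. For $\tau\in\partial\mathbb{B}$ and $x\in\mathbb{B}$, set $$d_\tau(x)=\frac{|1-\langle x,\tau\rangle|^2}{1-\|x\|^2}.$$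 *)

(* Defs.v *)
From mathcomp Require Import all_boot all_order all_algebra.
From mathcomp Require Export sesquilinear complex.
From mathcomp Require Export all_classical all_reals all_analysis.
From mathcomp Require Import ring lra.

Set Implicit Arguments.
Unset Strict Implicit.
Unset Printing Implicit Defensive.

Import Order.TTheory GRing.Theory Num.Theory.
Import numFieldNormedType.Exports.

Local Open Scope classical_set_scope.
Local Open Scope ring_scope.
Local Open Scope complex_scope.

(* A complex Hilbert space is a complete normed module H over R[i] together
   with a positive definite Hermitian form dot, linear in its first argument
   and conjugate-linear in its second, that induces the norm of H. *)
Definition norm_from_dot (R : realType) (H : completeNormedModType R[i])
    (dot : {dot H for Num.conj}) : Prop :=
  forall x : H, `|x| ^+ 2 = dot x x.

(* Norms over R[i] take (real) values in R[i]; rnorm is the same norm with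
   values in R. It applies both to vectors and to complex numbers. *)
Definition rnorm (R : realType) (V : normedZmodType R[i]) (x : V) : R :=
  complex.Re `|x|.

Definition tanh (R : realType) (u : R) : R :=
  (expR u - expR (- u)) / (expR u + expR (- u)).

Definition artanh (R : realType) (u : R) : R := ln ((1 + u) / (1 - u)) / 2.

Lemma artanhK (R : realType) (u : R) : -1 < u < 1 -> tanh (artanh u) = u.
Proof.
move=> /andP[u1 u2].
have h1 : 0 < 1 + u by lra.
have h2 : 0 < 1 - u by lra.
set e := expR (artanh u).
have e0 : 0 < e by exact: expR_gt0.
have e2 : e ^+ 2 = (1 + u) / (1 - u).
  rewrite /e -expRM_natl /artanh mulrC divfK ?lnK ?pnatr_eq0 //.
  by rewrite posrE divr_gt0.
have n1 : 1 - u != 0 by rewrite gt_eqF.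
rewrite /tanh expRN -/e.
have -> : (e - e^-1) / (e + e^-1) = (e ^+ 2 - 1) / (e ^+ 2 + 1).
  have : e ^+ 2 + 1 != 0 by rewrite gt_eqF // addr_gt0 // exprn_gt0.
  have : e != 0 by rewrite gt_eqF.
  move=> en en2; field.
  by rewrite en2 en.
rewrite e2; field.
by rewrite n1 /=; lra.
Qed.

Lemma tanhK (R : realType) (u : R) : artanh (tanh u) = u.
Proof.
have e0 := expR_gt0 u.
have f0 := expR_gt0 (- u).
rewrite /artanh /tanh.
set a := expR u in e0 *; set b := expR (- u) in f0 *.
have -> : (1 + (a - b) / (a + b)) / (1 - (a - b) / (a + b)) = expR (u + u).
  rewrite expRD -/a.
  have ab : a * b = 1 by rewrite /a /b -expRD subrr expR0.
  have bn : b != 0 by rewrite gt_eqF.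
  have -> : a * a = a / b.
    by apply: (mulIf bn); rewrite divfK // -mulrA ab mulr1.
  field.
  by rewrite bn !lt0r_neq0 //; lra.
by rewrite expRK; field.
Qed.

Section HilbertBall.
Context {R : realType} {H : completeNormedModType R[i]}.
Implicit Types (x y tau : H) (F : R -> H -> H) (f : H -> H).

Definition unit_ball : set H := [set x | `|x| < 1].
Definition unit_sphere : set H := [set x | `|x| = 1].

Section Metric.
Variable dot : {dot H for Num.conj}.

Definition sigma x y : R :=
  (1 - rnorm x ^+ 2) * (1 - rnorm y ^+ 2) / rnorm (1 - dot x y) ^+ 2.

Definition rho x y : R := artanh (Num.sqrt (1 - sigma x y)).

Definition d_ tau x : R := rnorm (1 - dot x tau) ^+ 2 / (1 - rnorm x ^+ 2).

Definition rho_nonexpansive (T : H -> H) : Prop :=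
  forall x y, unit_ball x -> unit_ball y -> rho (T x) (T y) <= rho x y.

End Metric.

(* Self-mappings of the unit ball are represented by total functions on H that
   preserve the ball; neither their values outside the ball nor F t for t < 0
   are constrained. *)
Definition continuous_semigroup F : Prop :=
  [/\ forall t x, 0 <= t -> unit_ball x -> unit_ball (F t x),
      forall t s x, 0 <= t -> 0 <= s -> unit_ball x ->
        F (t + s) x = F t (F s x)
    & forall x, unit_ball x -> F t x @[t --> (0 : R)^'+] --> x].

Definition generated_by F f : Prop :=
  forall x, unit_ball x -> t^-1%:C *: (x - F t x) @[t --> (0 : R)^'+] --> f x.

Definition null_point f x : Prop := unit_ball x /\ f x = 0.

Definition stationary_point F x : Prop :=
  unit_ball x /\ forall t, 0 <= t -> F t x = x.

End HilbertBall.

(* Main.v *)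
Require Import Defs.
From mathcomp Require Import all_boot all_order all_algebra.
From mathcomp Require Import ring lra.
Import Order.TTheory GRing.Theory Num.Theory.
Import numFieldNormedType.Exports.

Set Implicit Arguments.
Unset Strict Implicit.
Unset Printing Implicit Defensive.

Local Open Scope classical_set_scope.
Local Open Scope ring_scope.
Local Open Scope complex_scope.

(** For [x], [y] in the ball put
    K(x, y) = |1 - <x, y>|^2 / ((1 - |x|^2) (1 - |y|^2)), the squared hyperbolic
    cosine of [rho x y]; a map is [rho]-nonexpansive when it does not increase
    K. For a semigroup, the derivative at t = 0 of K(F_t x, F_t y) is therefore
    at most 0, which is an inequality between the pairs (x, f x) and (y, f y)
    (lemma [first_order]). Everything follows by choosing y and letting it move.

    The functions [horo u] : z |-> |1 - <z, u>|^2 / (1 - |z|^2) serve both for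
    |u| < 1, where they are multiples of K(., u), and for |u| = 1, where they are
    [d_ u]. The number [rate z u] has the sign of the derivative of [horo u]
    along the orbit of z at z; a bound on it integrates along orbits
    ([horo_flow]), since orbits are continuous although f need not be. If [rate]
    is nonpositive for some u of the ball, then u is stationary
    ([stationary_of_rate]). This applies to a null point u, so null points and
    stationary points coincide.

    For a null point free f one would look at the zeros u_e of f + e id as e
    tends to 0. Since f is not assumed continuous, u_e is instead a limit along
    an ultrafilter of h of the zeros of (id - F_h) / h + e id, which exist
    because F_h followed by a dilation is a strict contraction
    ([dilation_fixpoint]). These zeros have weak limits, and the first order
    inequality tested at the weak limit itself makes the convergence strong
    ([resolvent_limit]). The resulting family satisfies the inequalities of
    [resolvents]: with every orbit, and between any two of its members. The
    latter give |u_e - u_d|^2 <= |u_d|^2 - |u_e|^2 for d <= e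
    ([curve_compare]), so e |-> u_e is continuous and converges to some tau; the
    former become rate z tau <= 0 in the limit, so |tau| = 1 (otherwise tau is
    stationary) and tau is a sink with exponent 0 ([curve_limit]).

    The vector f (u_e) may differ from - e u_e, but letting u_e flow for a short
    time bounds it: (1 - |u_e|^2) |f (u_e)|^2 <= e^2 / 4 ([curve_speed]). As
    e = O(1 - |u_e|^2) ([curve_tail]), f (u_e) tends to 0.

    A sink is unique because two horoballs based at distinct points can be made
    to touch at exactly one point of the ball ([horoballs_touch]), and this
    point would be stationary. For the converse, y = r tau with r -> 1 in the
    first order inequality yields
    rate z tau <= - alpha |1 - <z, tau>|^2 (1 - |z|^2) ([boundary_rate]);
    then [horo tau] strictly decreases along orbits, so that no F_t with t > 0
    has a fixed point. *)

(** * The inner product in real coordinates *)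

Section RealForms.
Context (R : realType) (H : completeNormedModType R[i]).
Variable dot : {dot H for Num.conj}.
Implicit Types (x y z u v w : H) (a b c : R).

Definition re x y : R := complex.Re (dot x y).
Definition im x y : R := complex.Im (dot x y).
Definition sq x : R := re x x.

Lemma reDl x y z : re (x + y) z = re x z + re y z.
Proof. by rewrite /re linearDl /= raddfD. Qed.
Lemma imDl x y z : im (x + y) z = im x z + im y z.
Proof. by rewrite /im linearDl /= raddfD. Qed.

Lemma dotJ x y : dot x y = (dot y x)^*%C.
Proof. by have := hermC dot x y; rewrite /= expr0 mul1r. Qed.

Lemma re_sym x y : re x y = re y x.
Proof. by rewrite /re dotJ; case: (dot y x). Qed.
Lemma im_asym x y : im x y = - im y x.
Proof. by rewrite /im dotJ; case: (dot y x). Qed.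

Lemma reZl a x y : re (a%:C *: x) y = a * re x y.
Proof.
rewrite /re linearZl_LR /=; case: (dot x y) => p q /=.
by rewrite mul0r subr0.
Qed.
Lemma imZl a x y : im (a%:C *: x) y = a * im x y.
Proof.
rewrite /im linearZl_LR /=; case: (dot x y) => p q /=.
by rewrite mul0r addr0.
Qed.
Lemma re_il x y : re ('i%C *: x) y = - im x y.
Proof.
rewrite /re /im linearZl_LR /=; case: (dot x y) => p q /=.
by rewrite mul0r mul1r sub0r.
Qed.
Lemma im_il x y : im ('i%C *: x) y = re x y.
Proof.
rewrite /re /im linearZl_LR /=; case: (dot x y) => p q /=.
by rewrite mul0r mul1r add0r.
Qed.

Lemma reDr x y z : re z (x + y) = re z x + re z y.
Proof. by rewrite re_sym reDl !(re_sym z). Qed.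
Lemma imDr x y z : im z (x + y) = im z x + im z y.
Proof. by rewrite im_asym imDl !(im_asym z) opprD. Qed.
Lemma reZr a x y : re x (a%:C *: y) = a * re x y.
Proof. by rewrite re_sym reZl re_sym. Qed.
Lemma imZr a x y : im x (a%:C *: y) = a * im x y.
Proof. by rewrite im_asym imZl (im_asym x) mulrN. Qed.
Lemma re_ir x y : re x ('i%C *: y) = im x y.
Proof. by rewrite re_sym re_il im_asym opprK. Qed.
Lemma im_ir x y : im x ('i%C *: y) = - re x y.
Proof. by rewrite im_asym im_il re_sym. Qed.

Lemma re0l y : re 0 y = 0.
Proof. by have := reDl 0 0 y; rewrite addr0; lra. Qed.
Lemma im0l y : im 0 y = 0.
Proof. by have := imDl 0 0 y; rewrite addr0; lra. Qed.
Lemma re0r y : re y 0 = 0.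
Proof. by rewrite re_sym re0l. Qed.
Lemma im0r y : im y 0 = 0.
Proof. by rewrite im_asym im0l oppr0. Qed.
Lemma reNl x y : re (- x) y = - re x y.
Proof. by have := reDl (- x) x y; rewrite addNr re0l; lra. Qed.
Lemma imNl x y : im (- x) y = - im x y.
Proof. by have := imDl (- x) x y; rewrite addNr im0l; lra. Qed.
Lemma reNr x y : re x (- y) = - re x y.
Proof. by rewrite re_sym reNl re_sym. Qed.
Lemma imNr x y : im x (- y) = - im x y.
Proof. by rewrite im_asym imNl (im_asym x). Qed.
Lemma imxx x : im x x = 0.
Proof. by have := im_asym x x; lra. Qed.

Definition formE :=
  (reDl, imDl, reDr, imDr, reNl, imNl, reNr, imNr, reZl, imZl, reZr, imZr,
   re_il, im_il, re_ir, im_ir, (re0l, im0l, re0r, im0r, imxx)).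

Hypothesis dotE : norm_from_dot dot.

Lemma normE x : `|x| = (rnorm x)%:C.
Proof. by rewrite /rnorm RRe_real // normr_real. Qed.

Lemma rnorm_ge0 x : 0 <= rnorm x.
Proof. by rewrite -ler0c -normE normr_ge0. Qed.

Lemma sqE x : sq x = rnorm x ^+ 2.
Proof. by rewrite /sq /re -dotE normE -rmorphXn. Qed.

Lemma sq_ge0 x : 0 <= sq x.
Proof. by rewrite sqE exprn_ge0 // rnorm_ge0. Qed.

Lemma sq_eq0 x : sq x <= 0 -> x = 0.
Proof.
move=> x0; have {}x0 : sq x = 0 by apply/eqP; rewrite eq_le x0 sq_ge0.
apply/eqP; rewrite -normr_eq0 normE; apply/eqP.
by move: x0; rewrite sqE => /eqP; rewrite expf_eq0 /= => /eqP ->.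
Qed.

Lemma ballE x : unit_ball x <-> sq x < 1.
Proof.
rewrite /unit_ball /= normE -[1]/((1 : R)%:C) ltcR sqE.
by rewrite expr_lt1 // rnorm_ge0.
Qed.

Lemma sphereE x : unit_sphere x <-> sq x = 1.
Proof.
rewrite /unit_sphere /= normE sqE; split=> [[->]|/eqP]; first by rewrite expr1n.
rewrite sqrf_eq1 => /orP[/eqP -> //|/eqP x1].
by exfalso; have := rnorm_ge0 x; lra.
Qed.

Lemma cauchy_schwarz x y : re x y ^+ 2 + im x y ^+ 2 <= sq x * sq y.
Proof.
have [y0|y0] := leP (sq y) 0.
  by rewrite (sq_eq0 y0) /sq !formE; nra.
set p := re x y; set q := im x y.
have := sq_ge0 ((sq y)%:C *: x - p%:C *: y - q%:C *: ('i%C *: y)).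
rewrite /sq !formE -!/(sq _) (re_sym y x) (im_asym y x) -/p -/q.
set X := sq x; set Y := sq y in y0 *.
move=> h; have {h} : 0 <= Y * (X * Y - (p ^+ 2 + q ^+ 2)).
  by apply: le_trans h _; rewrite le_eqVlt; apply/orP; left; apply/eqP; ring.
by rewrite pmulr_rge0 // subr_ge0.
Qed.

Definition defect x : R := 1 - sq x.
Definition cross x y : R := (1 - re x y) ^+ 2 + im x y ^+ 2.

Lemma rnorm_crossE x y : rnorm (1 - dot x y) ^+ 2 = cross x y.
Proof.
rewrite /rnorm normc_def /= sqr_sqrtr ?addr_ge0 ?sqr_ge0 // /cross /re /im.
by rewrite raddfB /= (raddfB (@complex.Im R)) /= sub0r sqrrN.
Qed.

Lemma d_E tau x : d_ dot tau x = cross x tau / defect x.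
Proof. by rewrite /d_ /defect -sqE rnorm_crossE. Qed.
End RealForms.

(** * Strong and weak convergence *)

Section Limits.
Context (R : realType) (H : completeNormedModType R[i]).
Variable dot : {dot H for Num.conj}.
Hypothesis dotE : norm_from_dot dot.
Implicit Types (x y z u v w : H) (a b c : R).
Local Notation re := (re dot).
Local Notation im := (im dot).
Local Notation sq := (sq dot).

Lemma rnorm_ltE x (e : R) : 0 < e -> (`|x| < e%:C) = (sq x < e ^+ 2).
Proof.
move=> e0; rewrite normE ltcR sqE //.
by rewrite ltr_pXn2r // ?nnegrE ?rnorm_ge0 // ltW.
Qed.

(** The norm of H takes its values in R[i]; the squared real norm [sq] turns
    convergence in H into convergence in R. *)
Lemma cvg_sqP T (F : set_system T) {FF : Filter F} (g : T -> H) l :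
  g t @[t --> F] --> l <-> sq (g t - l) @[t --> F] --> (0 : R).
Proof.
split=> [/cvgrPdist_lt gl|gl].
  apply/cvgrPdist_lt => e e0.
  have se0 : 0 < Num.sqrt e by rewrite sqrtr_gt0.
  have := gl (Num.sqrt e)%:C; rewrite ltcR => /(_ se0).
  apply: filterS => t; rewrite distrC rnorm_ltE // sqr_sqrtr ?(ltW e0) // => h.
  by rewrite distrC subr0 ger0_norm // sq_ge0.
apply/cvgrPdist_lt => e e0.
have [e1 e2] : 0 < complex.Re e /\ e = (complex.Re e)%:C.
  have er : e \is Num.real by rewrite realE ltW.
  by rewrite RRe_real // -ltcR RRe_real.
rewrite e2; move/cvgrPdist_lt: gl => /(_ (complex.Re e ^+ 2)).
rewrite exprn_gt0 // => /(_ isT).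
apply: filterS => t; rewrite distrC subr0 ger0_norm ?sq_ge0 // => h.
by rewrite distrC rnorm_ltE.
Qed.

Lemma cvg_le0 T (F : set_system T) {FF : ProperFilter F} (g : T -> R) (l : R) :
  g t @[t --> F] --> l -> (\forall t \near F, g t <= 0) -> l <= 0.
Proof.
move=> gl g0; rewrite -(cvg_lim _ gl) //; apply: limr_le => //.
by apply/cvg_ex; exists l.
Qed.

Lemma sq_complete T (F : set_system T) {FF : ProperFilter F} (g : T -> H) :
  (forall e : R, 0 < e ->
     exists2 A : set T, F A & forall s t, A s -> A t -> sq (g s - g t) < e) ->
  exists l, sq (g t - l) @[t --> F] --> (0 : R).
Proof.
move=> cg; have : cauchy (g t @[t --> F]).
  apply: cauchy_exP => e e0.
  have [e1 e2] : 0 < complex.Re e /\ e = (complex.Re e)%:C.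
    have er : e \is Num.real by rewrite realE ltW.
    by rewrite RRe_real // -ltcR RRe_real.
  have [A FA hA] := cg (complex.Re e ^+ 2) (exprn_gt0 _ e1).
  have [s As] := filter_ex FA.
  exists (g s); rewrite e2.
  suff : F (g @^-1` ball (g s) (complex.Re e)%:C) by [].
  apply: filterS FA => t At.
  by rewrite /= -ball_normE /= rnorm_ltE //; apply: hA.
by move/cauchy_cvg/cvg_ex => [l /cvg_sqP gl]; exists l.
Qed.

Lemma cvg_small T (F : set_system T) {FF : Filter F} (g e : T -> R) (l : R) :
  e t @[t --> F] --> (0 : R) -> (\forall t \near F, (g t - l) ^+ 2 <= e t) ->
  g t @[t --> F] --> l.
Proof.
move=> /cvgrPdist_lt e0 ge; apply/cvgrPdist_lt => d d0.
have := e0 (d ^+ 2) (exprn_gt0 _ d0); apply: filterS2 ge => t get.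
rewrite sub0r normrN => /(le_lt_trans (ler_norm _)) /(le_lt_trans get) h.
by rewrite distrC ltr_norml; apply/andP; split; nra.
Qed.

(** Boundedness is part of the definition: a net may converge weakly without
    being eventually bounded. *)
Definition weakly T (F : set_system T) (g : T -> H) l :=
  (exists C : R, \forall t \near F, sq (g t) <= C) /\
  forall v, re (g t) v @[t --> F] --> re l v.

Lemma cvg_re T (F : set_system T) {FF : Filter F} (g h : T -> H) u v :
  sq (g t - u) @[t --> F] --> (0 : R) -> weakly F h v ->
  re (g t) (h t) @[t --> F] --> re u v.
Proof.
move=> gu [[C hC] hv].
have -> : re u v = 0 + re v u by rewrite add0r re_sym.
have -> : (fun t => re (g t) (h t)) = (fun t => re (g t - u) (h t) + re (h t) u).
  by apply/funext => t; rewrite !formE (re_sym dot (h t)); ring.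
apply: cvgD (hv u).
apply: (@cvg_small _ _ _ _ (fun t => sq (g t - u) * C)).
  by rewrite -[X in _ --> X](mul0r C); apply: cvgM => //; apply: cvg_cst.
apply: filterS hC => t hC; rewrite subr0.
have := cauchy_schwarz dotE (g t - u) (h t).
by have := sq_ge0 dotE (g t - u); nra.
Qed.

Lemma cvg_im T (F : set_system T) {FF : Filter F} (g h : T -> H) u v :
  sq (g t - u) @[t --> F] --> (0 : R) -> weakly F h v ->
  im (g t) (h t) @[t --> F] --> im u v.
Proof.
move=> gu hv.
have iE x y : im x y = - re ('i%C *: x) y by rewrite !formE opprK.
under eq_fun do rewrite iE.
rewrite iE; apply: cvgN; apply: cvg_re hv.
suff -> : (fun t => sq ('i%C *: g t - 'i%C *: u)) = (fun t => sq (g t - u)) by [].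
by apply/funext => t; rewrite -scalerBr /sq !formE; ring.
Qed.

Lemma cvg_sq T (F : set_system T) {FF : Filter F} (g : T -> H) u :
  sq (g t - u) @[t --> F] --> (0 : R) -> sq (g t) @[t --> F] --> sq u.
Proof.
move=> gu.
have wu : weakly F (fun=> u) u.
  by split; [exists (sq u); near=> t | move=> v; apply: cvg_cst].
have -> : sq u = 0 + 2 * re u u - sq u by rewrite /sq; ring.
have -> : (fun t => sq (g t)) = (fun t => sq (g t - u) + 2 * re (g t) u - sq u).
  by apply/funext => t; rewrite /sq !formE (re_sym dot u); ring.
apply: cvgB; last exact: cvg_cst.
apply: cvgD => //; apply: cvgM; first exact: cvg_cst.
exact: cvg_re.
Unshelve. all: by end_near. Qed.

Lemma strong_weakly T (F : set_system T) {FF : Filter F} (g : T -> H) u :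
  sq (g t - u) @[t --> F] --> (0 : R) -> weakly F g u.
Proof.
move=> gu; split.
  exists (sq u + 1).
  by apply: (cvgr_le (sq u)); [exact: cvg_sq | rewrite ltrDl].
move=> v; apply: cvg_re => //; split; last by move=> w; apply: cvg_cst.
by exists (sq v); near=> t.
Unshelve. all: by end_near. Qed.

Lemma sqZ a x : sq (a%:C *: x) = a ^+ 2 * sq x.
Proof. by rewrite /sq !formE; ring. Qed.

Lemma weaklyZ T (F : set_system T) {FF : Filter F} a (v_ : T -> H) v : weakly F v_ v ->
  weakly F (fun h => a%:C *: v_ h) (a%:C *: v).
Proof.
move=> [[C hC] vl]; split.
  exists (a ^+ 2 * C); apply: filterS hC => h hC.
  by rewrite sqZ ler_wpM2l ?sqr_ge0.
move=> w; rewrite reZl.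
have -> : (fun h => re (a%:C *: v_ h) w) = (fun h => a * re (v_ h) w).
  by apply/funext => h; rewrite reZl.
have vw := vl w.
by apply: cvgM => //; exact: cvg_cst.
Qed.

Lemma ultra_cvg T (U : set_system T) {UU : UltraFilter U} (g : T -> R) (C : R) :
  (\forall t \near U, - C <= g t <= C) -> exists l : R, g t @[t --> U] --> l.
Proof.
move=> gC.
have [l [_ cl]] : (`[- C, C] `&` cluster (g t @[t --> U])) !=set0.
  apply: segment_compact; apply: filterS gC => t /=.
  by rewrite in_itv.
exists l => B lB; have [//|nB] := in_ultra_setVsetC (g @^-1` B) UU.
by have [x [nBx /nBx]] := cl (~` B) B nB lB.
Qed.

(** Let l v be the limit of <g t, v> along U. The functional sq v - 2 l v is
    bounded below, and by the parallelogram identity its minimizing sequences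
    are Cauchy; its minimizer represents l, hence is the weak limit. *)
Lemma weak_limit T (U : set_system T) {UU : UltraFilter U} (g : T -> H) (C : R) :
  (\forall t \near U, sq (g t) <= C) -> exists l, weakly U g l.
Proof.
move=> gC.
have [l lE] : {l : H -> R & forall v, re (g t) v @[t --> U] --> l v}.
  apply: (@choice _ _ (fun v (a : R) => re (g t) v @[t --> U] --> a)) => v.
  apply: (@ultra_cvg _ _ _ _ (C + sq v)).
  apply: filterS gC => t gC.
  have := sq_ge0 dotE (g t - v); have := sq_ge0 dotE (g t + v).
  have := sq_ge0 dotE (g t); have := sq_ge0 dotE v.
  by rewrite /sq !formE -!/(sq _) (re_sym dot v) => *; lra.
have llin a v w : l (a%:C *: v + w) = a * l v + l w.
  have h1 := lE (a%:C *: v + w).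
  have h2 : re (g t) (a%:C *: v + w) @[t --> U] --> a * l v + l w.
    under eq_fun do rewrite reDr reZr.
    by apply: cvgD => //; apply: cvgM => //; apply: cvg_cst.
  exact: (cvg_unique _ h1 h2).
pose J v := sq v - 2 * l v.
have JC v : - C <= J v.
  rewrite -subr_le0.
  have h : - C - (sq v - 2 * re (g t) v) @[t --> U] --> - C - J v.
    apply: cvgB; first exact: cvg_cst.
    apply: cvgB; first exact: cvg_cst.
    by apply: cvgM => //; apply: cvg_cst.
  apply: cvg_le0 h _; apply: filterS gC => t gC.
  have := sq_ge0 dotE (g t - v).
  by rewrite /sq !formE -!/(sq _) (re_sym dot v) => *; lra.
pose m := inf (range J).
have hi : has_inf (range J).
  by split; [exists (J 0), 0 | exists (- C) => _ [v _ <-]].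
have mJ v : m <= J v by apply: ge_inf; [exact: hi.2 | exists v].
have [s sm] : {s : nat -> H & forall n, J (s n) < m + n.+1%:R^-1}.
  apply: (@choice _ _ (fun n v => J v < m + n.+1%:R^-1)) => n.
  have n0 : 0 < n.+1%:R^-1 :> R by rewrite invr_gt0.
  by have [_ [v _ <-] vm] := inf_adherent n0 hi; exists v.
have [u su] : exists u, sq (s n - u) @[n --> \oo] --> (0 : R).
  apply: sq_complete => e e0.
  exists [set n | n.+1%:R^-1 < e / 4].
    by apply: near_infty_natSinv_lt (PosNum (divr_gt0 e0 _)).
  move=> i j /= ie je.
  (* sq (s i - s j) = 2 J (s i) + 2 J (s j) - 4 J mid, and m <= J mid *)
  pose mid := (2^-1)%:C *: s i + (2^-1)%:C *: s j.
  have lm : l mid = 2^-1 * l (s i) + 2^-1 * l (s j).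
    have l0 : l 0 = 0 by have := llin 1 0 0; rewrite scaler0 addr0; lra.
    by rewrite /mid llin -[_ *: s j]addr0 llin l0 addr0.
  have := mJ mid; have := sm i; have := sm j; rewrite /J lm /mid /sq !formE.
  rewrite (re_sym dot (s j) (s i)); move: ie je.
  by move: i.+1%:R^-1 j.+1%:R^-1 => p q; lra.
exists u; split; first by exists C.
move=> v; suff -> : re u v = l v by [].
(* first variation of J at the minimizer u in the direction v *)
have key a : 0 <= 2 * a * (re u v - l v) + a ^+ 2 * sq v.
  rewrite -oppr_le0.
  have h : - (n.+1%:R^-1 + (2 * a * (re (s n) v - l v) + a ^+ 2 * sq v)) @[n --> \oo] -->
     - (0 + (2 * a * (re u v - l v) + a ^+ 2 * sq v)).
    apply: cvgN; apply: cvgD; first exact: cvg_harmonic.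
    apply: cvgD; last exact: cvg_cst.
    apply: cvgM; first exact: cvg_cst.
    apply: cvgB; last exact: cvg_cst.
    by apply: (strong_weakly su).2.
  rewrite add0r in h; apply: cvg_le0 h _.
  near=> n; have := mJ (a%:C *: v + s n); have := sm n.
  rewrite /J llin /sq !formE (re_sym dot v (s n)).
  by set q := _^-1; move=> *; lra.
have S0 := sq_ge0 dotE v.
have := key (- (re u v - l v) / (sq v + 1)).
set X := re u v - l v; set S := sq v in S0 *.
have -> : 2 * (- X / (S + 1)) * X + (- X / (S + 1)) ^+ 2 * S =
   - (X ^+ 2 * (S + 2) / (S + 1) ^+ 2) by field; lra.
rewrite oppr_ge0 pmulr_lle0 ?invr_gt0 ?exprn_gt0 ?ltr_wpDl //.
rewrite pmulr_lle0 ?ltr_wpDl // => X0.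
by apply/eqP; rewrite -subr_eq0 -sqrf_eq0 eq_le X0 sqr_ge0.
Unshelve. all: by end_near. Qed.

Lemma sqC x y : sq (x - y) = sq (y - x).
Proof. by rewrite /sq !formE; ring. Qed.

Lemma sq_subr0_eq x y : sq (x - y) <= 0 -> x = y.
Proof. by move=> h; apply/eqP; rewrite -subr_eq0; apply/eqP/(sq_eq0 dotE). Qed.

Lemma sq_cvg_uniq (T : Type) (G : set_system T) {GG : ProperFilter G} (g : T -> H) x y :
  sq (g t - x) @[t --> G] --> (0 : R) -> sq (g t - y) @[t --> G] --> (0 : R) -> x = y.
Proof.
move=> /cvg_sqP gx /cvg_sqP gy.
exact: (cvg_unique _ gx gy).
Qed.
End Limits.

(** * Nonexpansive maps of the hyperbolic metric *)

Section Hyperbolic.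
Context (R : realType) (H : completeNormedModType R[i]).
Variable dot : {dot H for Num.conj}.
Hypothesis dotE : norm_from_dot dot.
Implicit Types (x y z u v w : H) (a b c : R) (T : H -> H).
Local Notation re := (re dot).
Local Notation im := (im dot).
Local Notation sq := (sq dot).
Local Notation defect := (defect dot).
Local Notation cross := (cross dot).

(** (K(x, y) - 1) times the denominator of K(x, y). *)
Definition excess x y : R := cross x y - defect x * defect y.

Lemma excessE x y :
  excess x y = sq (x - y) - (sq x * sq y - re x y ^+ 2 - im x y ^+ 2).
Proof.
rewrite /excess /cross /defect /sq !formE (re_sym dot y x); ring.
Qed.

(** The Gram determinant of x and y equals that of x - y and y, which is at most
    sq (x - y) * sq y. *)
Lemma excess_ge_sq x y : sq (x - y) * defect y <= excess x y.
Proof.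
have := cauchy_schwarz dotE (x - y) y.
rewrite excessE /defect /sq !formE (re_sym dot y x).
by move=> h; have := sqr_ge0 (re x y - re y y); have := sqr_ge0 (im x y); nra.
Qed.

Lemma excess_le_sq x y : excess x y <= sq (x - y).
Proof. by rewrite excessE; have := cauchy_schwarz dotE x y; lra. Qed.

Lemma cross_gt0 x y : sq x < 1 -> sq y <= 1 -> 0 < cross x y.
Proof.
move=> x1 y1; have := cauchy_schwarz dotE x y.
have := sq_ge0 dotE x; have := sq_ge0 dotE y; rewrite /cross => y0 x0 h.
have p1 : re x y < 1 by have := sqr_ge0 (im x y); nra.
by rewrite ltr_pwDl ?sqr_ge0 // exprn_gt0 // subr_gt0.
Qed.

(** K (T x) (T y) <= K x y without denominators. *)
Definition schwarz_pick T := forall x y, sq x < 1 -> sq y < 1 ->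
  cross (T x) (T y) * (defect x * defect y) <=
  cross x y * (defect (T x) * defect (T y)).

Lemma artanh_le (s t : R) : 0 <= s < 1 -> 0 <= t < 1 -> artanh s <= artanh t ->
  s <= t.
Proof.
move=> /andP[s0 s1] /andP[t0 t1].
have ds : 0 < 1 - s by rewrite subr_gt0.
have dt : 0 < 1 - t by rewrite subr_gt0.
have ns : 0 < 1 + s by rewrite ltr_pwDl.
have nt : 0 < 1 + t by rewrite ltr_pwDl.
rewrite /artanh ler_pM2r ?invr_gt0 // ler_ln ?posrE ?divr_gt0 //.
rewrite ler_pdivrMr // mulrAC ler_pdivlMr // => h.
by lra.
Qed.

Lemma rho_schwarz_pick T :
  (forall x, sq x < 1 -> sq (T x) < 1) -> rho_nonexpansive dot T ->
  schwarz_pick T.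
Proof.
move=> TB Tn x y x1 y1.
have sigmaE u v : sigma dot u v = defect u * defect v / cross u v.
  by rewrite /sigma -!(sqE dotE) rnorm_crossE.
have key u v : sq u < 1 -> sq v < 1 ->
    [/\ 0 < sigma dot u v, 0 <= 1 - sigma dot u v & 0 < cross u v].
  move=> u1 v1; have c0 : 0 < cross u v by apply: cross_gt0 => //; lra.
  have u0 : 0 < defect u by rewrite subr_gt0.
  have v0 : 0 < defect v by rewrite subr_gt0.
  rewrite sigmaE subr_ge0 ler_pdivrMr // mul1r; split=> //.
    by rewrite divr_gt0 // mulr_gt0.
  have := excess_ge_sq u v; rewrite /excess.
  by have := sq_ge0 dotE (u - v); nra.
have [s1 s2 s3] := key _ _ x1 y1.
have [t1 t2 t3] := key _ _ (TB _ x1) (TB _ y1).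
have sq1 (a : R) : 0 < a -> 0 <= 1 - a -> 0 <= Num.sqrt (1 - a) < 1.
  move=> a0 a1; rewrite sqrtr_ge0 /= -[ltRHS]sqrtr1 ltr_sqrt //; lra.
have := Tn x y; rewrite !(ballE dotE) => /(_ x1 y1) /artanh_le.
move=> /(_ (sq1 _ t1 t2) (sq1 _ s1 s2)).
rewrite ler_psqrt ?nnegrE // !sigmaE lerD2l lerN2.
rewrite ler_pdivrMr // mulrAC ler_pdivlMr //.
by rewrite mulrC [leRHS]mulrC.
Qed.

(** The norm is controlled by K - 1 at the images and controls it at the
    sources, hence nonexpansive maps are continuous. *)
Lemma schwarz_pick_sq T x y :
  (forall x, sq x < 1 -> sq (T x) < 1) -> schwarz_pick T ->
  sq x < 1 -> sq y < 1 -> sq (T x - T y) * (defect x * defect y) <= sq (x - y).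
Proof.
move=> TB TP x1 y1; apply: le_trans (excess_le_sq x y).
have := TP x y x1 y1; have := excess_ge_sq (T x) (T y).
have a0 : 0 < defect x by rewrite subr_gt0.
have b0 : 0 < defect y by rewrite subr_gt0.
have c0 : 0 < defect (T x) by rewrite subr_gt0 TB.
have d0 : 0 < defect (T y) by rewrite subr_gt0 TB.
have c1 : defect (T x) <= 1 by rewrite gerBl sq_ge0.
have e0 : 0 <= excess x y.
  by apply: le_trans (excess_ge_sq x y); rewrite mulr_ge0 ?sq_ge0 // ltW.
move: e0; rewrite /excess.
set A := defect x in a0 *; set B := defect y in b0 *.
set C := defect (T x) in c0 c1 *; set D := defect (T y) in d0 *.
set s := sq _; set k := cross x y; set k' := cross _ _.
move=> e0 h1 h2.
rewrite -(ler_pM2r d0); apply: (@le_trans _ _ ((k - A * B) * (C * D))).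
  have : (s * D) * (A * B) <= (k' - C * D) * (A * B).
    by rewrite ler_pM2r ?mulr_gt0.
  by lra.
by rewrite mulrA ler_pM2r // ler_piMr.
Qed.

(** The dilation of ratio r multiplies K - 1 by at most r ^ 2. *)
Lemma excess_dilation (r : R) u v : 0 < r < 1 -> sq u < 1 -> sq v < 1 ->
  excess (r%:C *: u) (r%:C *: v) * (defect u * defect v) <=
  r ^+ 2 * excess u v * (defect (r%:C *: u) * defect (r%:C *: v)).
Proof.
move=> /andP[r0 r1] u1 v1.
have g := excess_ge_sq u v; have e := excessE u v.
rewrite [excess (r%:C *: u) _]excessE -scalerBr !sqZ !formE.
rewrite /defect !sqZ -!/(defect _).
set E := excess u v in g e *; set S := sq (u - v) in g e *.
have S0 : 0 <= S by apply: sq_ge0.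
have u0 := sq_ge0 dotE u; have v0 := sq_ge0 dotE v.
set U := sq u in u0 u1 e *; set V := sq v in v0 v1 e *.
have gE : defect v = 1 - V by [].
rewrite gE in g.
have r2 : 0 < r ^+ 2 < 1 by rewrite exprn_gt0 // expr_lt1 // ltW.
have [q qr] : exists q, q = r ^+ 2 by exists (r ^+ 2).
rewrite -qr in r2 *.
set p := re u v in e *; set t := im u v in e *.
have -> : q * S - (q * U * (q * V) - (r * (r * p)) ^+ 2 - (r * (r * t)) ^+ 2) =
   q * (S - q * (S - E)) by rewrite e qr; ring.
have qE : (S - q * (S - E)) * (1 - V) <= E * (1 - q * V).
  rewrite -subr_ge0.
  have -> : E * (1 - q * V) - (S - q * (S - E)) * (1 - V) =
    (1 - q) * (E - S * (1 - V)) by ring.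
  by rewrite mulr_ge0 ?subr_ge0 // ltW //; case/andP: r2.
have E0 : 0 <= E by apply: le_trans g; rewrite mulr_ge0 //; lra.
have h1 : 1 - U <= 1 - q * U by nra.
have h2 : 0 <= 1 - U by lra.
have h3 : 0 <= E * (1 - q * V) by rewrite mulr_ge0 //; nra.
rewrite -[q * _ * _]mulrA -[leRHS]mulrA ler_pM2l; last by case/andP: r2.
apply: (@le_trans _ _ (E * (1 - q * V) * (1 - U))).
  by have := ler_wpM2r h2 qE; rewrite /defect -/U -/V; lra.
by have := ler_wpM2l h3 h1; lra.
Qed.

Lemma rnormD x y : rnorm (x + y) <= rnorm x + rnorm y.
Proof. by rewrite -lecR rmorphD /= -!normE ler_normD. Qed.

(** Picard iteration from 0. The quantity K - 1 between consecutive iterates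
    decreases geometrically and dominates their squared distance, so that the
    iterates are Cauchy for the norm; they stay in the ball of radius r. *)
Lemma dilation_fixpoint T (r : R) :
  (forall x, sq x < 1 -> sq (T x) < 1) -> schwarz_pick T -> 0 < r < 1 ->
  exists2 p, sq p < 1 & p = r%:C *: T p.
Proof.
move=> TB TP r01; have /andP[r0 r1] := r01.
pose G x := r%:C *: T x; pose s n := iter n G 0.
have r2 : r ^+ 2 < 1 by rewrite expr_lt1 // ltW.
have r20 : 0 < r ^+ 2 by rewrite exprn_gt0.
have sr n : sq (s n) <= r ^+ 2.
  elim: n => [|n IH]; first by rewrite /sq !formE ltW.
  rewrite /= sqZ ler_piMr ?ltW // TB //; lra.
have s1 n : sq (s n) < 1 by apply: le_lt_trans (sr n) _.
have d0 n : 0 < defect (s n) by rewrite subr_gt0.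
pose e n := excess (s n.+1) (s n) / (defect (s n.+1) * defect (s n)).
have eS n : e n.+1 <= r ^+ 2 * e n.
  rewrite /e ler_pdivrMr ?mulr_gt0 // mulrA mulrAC ler_pdivlMr ?mulr_gt0 //.
  have h1 := excess_dilation r01 (TB _ (s1 n.+1)) (TB _ (s1 n)).
  have h2 := TP _ _ (s1 n.+1) (s1 n).
  rewrite -[r%:C *: _]/(s n.+2) -[r%:C *: T (s n)]/(s n.+1) in h1.
  have a0 : 0 < defect (T (s n.+1)) by rewrite subr_gt0 TB.
  have b0 : 0 < defect (T (s n)) by rewrite subr_gt0 TB.
  have h3 : excess (T (s n.+1)) (T (s n)) * (defect (s n.+1) * defect (s n)) <=
    excess (s n.+1) (s n) * (defect (T (s n.+1)) * defect (T (s n))).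
    by rewrite /excess; lra.
  rewrite -(ler_pM2r (mulr_gt0 a0 b0)).
  set P := defect (s n.+1) * defect (s n) in h3 *.
  have P0 : 0 < P by rewrite mulr_gt0.
  set Q := defect (s n.+2) * _ in h1 *.
  have Q0 : 0 < Q by rewrite mulr_gt0.
  set K := defect _ * _ in h1 h3 *.
  rewrite mulrAC; apply: le_trans (ler_wpM2r (ltW P0) h1) _.
  rewrite [leRHS](_ : _ = (excess (s n.+1) (s n) * K) * (r ^+ 2 * Q)); last by ring.
  rewrite [leLHS](_ : _ = excess (T (s n.+1)) (T (s n)) * P * (r ^+ 2 * Q)); last by ring.
  by rewrite ler_pM2r // mulr_gt0.
have e0 : 0 <= e 0%N.
  apply: divr_ge0; last by rewrite ltW // mulr_gt0.
  apply: le_trans (excess_ge_sq _ _).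
  by rewrite mulr_ge0 ?sq_ge0 // ltW.
have en n : e n <= (r ^+ n) ^+ 2 * e 0%N.
  elim: n => [|n IH]; first by rewrite expr0 expr1n mul1r.
  rewrite (exprS r n) (exprMn _ r) -(mulrA (r ^+ 2)); apply: le_trans (eS n) _.
  by rewrite ler_pM2l.
have step n : rnorm (s n.+1 - s n) <= r ^+ n * (1 + e 0%N).
  have rn : 0 < r ^+ n by rewrite exprn_gt0.
  have ee : 0 < 1 + e 0%N by rewrite ltr_pwDl.
  have rK : 0 <= r ^+ n * (1 + e 0%N) by rewrite ltW // mulr_gt0.
  rewrite -(@ler_pXn2r _ 2) ?nnegrE ?rnorm_ge0 //.
  rewrite -(sqE dotE).
  apply: (@le_trans _ _ (e n)).
    rewrite /e ler_pdivlMr ?mulr_gt0 //; apply: le_trans (excess_ge_sq _ _).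
    rewrite mulrA ler_pM2r // ler_piMr ?sq_ge0 // gerBl sq_ge0 //.
  apply: le_trans (en n) _; rewrite (exprMn _ (r ^+ n)) ler_wpM2l ?sqr_ge0 //.
  by have : 0 <= e 0%N ^+ 2 by [rewrite sqr_ge0]; lra.
pose K := (1 + e 0%N) / (1 - r).
have K0 : 0 < K by rewrite divr_gt0; lra.
have KE : 1 + e 0%N = K * (1 - r) by rewrite divfK //; lra.
have far n j : rnorm (s (n + j)%N - s n) <= K * (r ^+ n - r ^+ (n + j)).
  elim: j => [|j IH]; first by rewrite addn0 !subrr mulr0 /rnorm normr0.
  rewrite addnS -(subrK (s (n + j)%N) (s _)) -addrA.
  apply: le_trans (rnormD _ _) _.
  have := step (n + j)%N; rewrite KE exprS => h.
  by move: IH h; set x := r ^+ (n + j); set y := rnorm _; set z := rnorm _; nra.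
have farK n j : (n <= j)%N -> sq (s j - s n) <= (K * r ^+ n) ^+ 2.
  move=> /subnKC <-; rewrite (sqE dotE).
  have rK : 0 <= K * r ^+ n by rewrite ltW // mulr_gt0 // exprn_gt0.
  rewrite ler_pXn2r ?nnegrE ?rnorm_ge0 //.
  apply: le_trans (far n _) _; rewrite ler_pM2l // gerBl exprn_ge0 // ltW //.
have [p sp] : exists p, sq (s n - p) @[n --> \oo] --> (0 : R).
  apply: sq_complete => // d d0'.
  exists [set n | (K * r ^+ n) ^+ 2 < d].
    have h : (K * r ^+ n) ^+ 2 @[n --> \oo] --> (K * 0) ^+ 2.
      have h1 : r ^+ n @[n --> \oo] --> 0 by apply: cvg_expr; rewrite ger0_norm // ltW.
      have h2 : K * r ^+ n @[n --> \oo] --> K * 0 by apply: cvgM => //; apply: cvg_cst.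
      by apply: cvgM.
    by rewrite mulr0 expr0n /= in h; apply: (cvgr_lt _ h).
  move=> i j /= hi hj.
  case: (leqP i j) => ij; last first.
    by apply: le_lt_trans (farK _ _ (ltnW ij)) hj.
  by rewrite sqC; apply: le_lt_trans (farK _ _ ij) hi.
have pr : sq p <= r ^+ 2.
  have h : sq (s n) - r ^+ 2 @[n --> \oo] --> sq p - r ^+ 2.
    by apply: cvgB; [exact: cvg_sq | exact: cvg_cst].
  rewrite -subr_le0; apply: cvg_le0 h _.
  by near=> n; rewrite subr_le0.
have p1 : sq p < 1 by apply: le_lt_trans pr _.
exists p => //; apply/eqP; rewrite -subr_eq0; apply/eqP/(sq_eq0 dotE).
have dp : 0 < defect p by rewrite subr_gt0.
pose k := (1 - r ^+ 2) * defect p.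
have k0 : 0 < k by rewrite mulr_gt0 // subr_gt0.
have h : sq (p - r%:C *: T p) -
   (2 * sq (s n.+1 - p) + 2 * (sq (s n - p) / k)) @[n --> \oo] -->
   sq (p - r%:C *: T p) - (2 * 0 + 2 * (0 / k)).
  apply: cvgB; first exact: cvg_cst.
  apply: cvgD; apply: cvgM; try exact: cvg_cst.
    by have := sp; rewrite -(cvg_shiftS (fun n => sq (s n - p))).
  by apply: cvgM; try exact: cvg_cst.
rewrite mul0r !mulr0 addr0 subr0 in h; apply: cvg_le0 h _.
near=> n; rewrite subr_le0.
have h1 : sq (T (s n) - T p) <= sq (s n - p) / k.
  rewrite ler_pdivlMr //; apply: le_trans (schwarz_pick_sq TB TP (s1 n) p1).
  rewrite ler_wpM2l ?sq_ge0 // /k ler_pM2r // lerD2l lerN2 //.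
have h2 : sq (s n.+1 - r%:C *: T p) <= sq (T (s n) - T p).
  by rewrite /= -scalerBr sqZ ler_piMl ?sq_ge0 // ltW.
have := sq_ge0 dotE ((s n.+1 - p) + (s n.+1 - r%:C *: T p)).
have -> : sq (p - r%:C *: T p) = 2 * sq (s n.+1 - p) + 2 * sq (s n.+1 - r%:C *: T p)
   - sq ((s n.+1 - p) + (s n.+1 - r%:C *: T p)).
  rewrite /sq; move: (s n.+1) (r%:C *: T p) => a b; rewrite !formE.
  by rewrite (re_sym dot b a) (re_sym dot p a) (re_sym dot b p); ring.
by lra.
Unshelve. all: by end_near. Qed.
End Hyperbolic.

(** * One-sided derivatives *)

Lemma near_rightP (R : realType) (P : R -> Prop) (x : R) :
  (\forall h \near x^'+, P h) -> exists2 d : R, 0 < d &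
    forall h, 0 < h < d -> P (x + h).
Proof.
move=> /nbhs_ballP [d /= d0 hd]; exists d => // h /andP[h0 hd'].
apply: hd; last by rewrite /= ltrDl.
by rewrite /ball /= opprD addNKr normrN gtr0_norm.
Qed.

Lemma near_left1 (R : realType) (P : R -> Prop) : (\forall h \near (0 : R)^'+, P h) ->
  \forall r \near (1 : R)^'-, P (1 - r).
Proof.
move=> /near_rightP [d d0 hd]; near=> r.
have r1 : r < 1 by near: r; exact: nbhs_left_lt.
have rd : 1 - d < r by near: r; apply: nbhs_left_gt; rewrite ltrBlDr ltrDl.
have := hd (1 - r); rewrite add0r; apply.
by rewrite subr_gt0 r1 /=; lra.
Unshelve. all: by end_near. Qed.

(** For e > 0, the set of the t such that g s <= g 0 + e s on [0, t] is closed
    by left continuity and cannot stop before T by the bound on the right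
    derivative. *)
Lemma nonincreasing_dini (R : realType) (g : R -> R) (T : R) : 0 < T ->
  (forall s : R, 0 < s <= T -> g (s - h) @[h --> (0 : R)^'+] --> g s) ->
  (forall s e : R, 0 <= s < T -> 0 < e ->
    \forall h \near (0 : R)^'+, g (s + h) <= g s + e * h) ->
  g T <= g 0.
Proof.
move=> T0 gl gr.
suff key e : 0 < e -> g T <= g 0 + e * T.
  rewrite leNgt; apply/negP => gT.
  pose e := (g T - g 0) / (2 * T).
  have e0 : 0 < e by rewrite divr_gt0 ?mulr_gt0 // subr_gt0.
  have eE : g T - g 0 = e * (2 * T) by rewrite /e divfK // mulf_neq0 // gt_eqF.
  by have := key e e0; nra.
move=> e0.
pose S := [set t : R | 0 <= t <= T /\ forall s, 0 <= s <= t -> g s <= g 0 + e * s].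
have S0 : S 0.
  split; first by rewrite lexx ltW.
  move=> s s0; have -> : s = 0 by lra.
  by rewrite mulr0 addr0.
have hS : has_sup S.
  by split; [exists 0 | exists T => t [/andP[]]].
pose m := sup S.
have m0 : 0 <= m by exact: (ub_le_sup hS.2 S0).
have mT : m <= T by apply: ge_sup; [exists 0 | move=> t [/andP[_ tT] _]].
have below s : 0 <= s < m -> g s <= g 0 + e * s.
  move=> /andP[s0 sm].
  have [t [_ tS] st] := sup_adherent (ltac:(by rewrite subr_gt0; exact: sm) : 0 < m - s) hS.
  by apply: tS; rewrite s0 /=; apply: ltW; move: st; rewrite opprB addrC subrK.
have Sm : S m.
  split=> [|s /andP[s0]]; first by rewrite m0.
  rewrite le_eqVlt => /orP[/eqP -> {s s0}|sm]; last by apply: below; rewrite s0.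
  move: m0; rewrite le_eqVlt => /orP[/eqP <-|m0]; first by rewrite mulr0 addr0.
  have h : g (m - h) - (g 0 + e * m) @[h --> (0 : R)^'+] --> g m - (g 0 + e * m).
    by apply: cvgB; [apply: gl; rewrite m0 | exact: cvg_cst].
  rewrite -subr_le0; apply: cvg_le0 h _; near=> h.
  have h0 : 0 < h by near: h; exact: nbhs_right_gt.
  have hm : h < m by near: h; exact: nbhs_right_lt.
  have : g (m - h) <= g 0 + e * (m - h) by apply: below; lra.
  by nra.
move: mT; rewrite le_eqVlt => /orP[/eqP mT|mT].
  by rewrite -mT; apply: Sm.2; rewrite m0 lexx.
exfalso; have [d d0 hd] := near_rightP (gr m e (ltac:(by rewrite m0)) e0).
pose d' := Num.min (d / 2) (T - m).
have d'0 : 0 < d' by rewrite lt_min divr_gt0 //= subr_gt0.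
have d'd : d' < d by rewrite gt_min; apply/orP; left; lra.
have d'T : d' <= T - m by rewrite ge_min lexx orbT.
have : S (m + d').
  split=> [|s /andP[s0 sd]]; first by lra.
  have [sm|ms] := leP s m; first by apply: Sm.2; rewrite s0.
  have h : g (m + (0 + (s - m))) <= g m + e * (0 + (s - m)) by apply: hd; lra.
  have {}h : g s <= g m + e * (s - m) by rewrite add0r addrC subrK in h.
  by have := Sm.2 m; rewrite m0 lexx => /(_ isT); lra.
move=> /(ub_le_sup hS.2); rewrite -/m; lra.
Unshelve. all: by end_near. Qed.

(** Limits of arithmetic expressions in [re], [im] and [sq]; dispatching on the
    head symbol of the expression avoids costly failed unifications. *)
Ltac cvg_form := repeat lazymatch goal with
  | |- cvg_to (nbhs (fmap (fun _ => ?c) _)) _ => exact: cvg_cst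
  | |- cvg_to (nbhs (fmap (fun h => @Algebra.add _ (@?a h) (@?b h)) _)) _ =>
    apply: cvgD
  | |- cvg_to (nbhs (fmap (fun h => @Algebra.opp _ (@?a h)) _)) _ => apply: cvgN
  | |- cvg_to (nbhs (fmap (fun h => @GRing.mul _ (@?a h) (@?b h)) _)) _ =>
    apply: cvgM
  | |- cvg_to (nbhs (fmap (fun h => re _ (@?a h) (@?b h)) _)) _ => exact: cvg_re
  | |- cvg_to (nbhs (fmap (fun h => im _ (@?a h) (@?b h)) _)) _ => exact: cvg_im
  | |- cvg_to (nbhs (fmap (fun h => sq _ (@?a h)) _)) _ => first [assumption | exact: cvg_sq]
  | |- cvg_to (nbhs (fmap (@Algebra.add _ ?a) _)) _ => apply: cvgD
  | |- cvg_to (nbhs (fmap (@Algebra.opp _) _)) _ => apply: cvgN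
  | |- cvg_to (nbhs (fmap (@GRing.mul _ ?a) _)) _ => apply: cvgM
  | |- cvg_to _ _ => assumption
  end.

(** * First variation of the hyperbolic metric and of horofunctions *)

Section FirstOrder.
Context (R : realType) (H : completeNormedModType R[i]).
Variable dot : {dot H for Num.conj}.
Hypothesis dotE : norm_from_dot dot.
Implicit Types (x y z u v w : H) (a b c : R).
Local Notation re := (re dot).
Local Notation im := (im dot).
Local Notation sq := (sq dot).
Local Notation defect := (defect dot).
Local Notation cross := (cross dot).

(** The derivative at h = 0 of cross (z - h v) (u - h w). *)
Definition dcross z u v w : R :=
  2 * (1 - re z u) * (re v u + re z w) - 2 * im z u * (im v u + im z w).

Lemma crossB z u v w (h : R) :
  cross (z - h%:C *: v) (u - h%:C *: w) = cross z u + h *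
    (2 * (1 - re z u) * (re v u + re z w - h * re v w) -
     2 * im z u * (im v u + im z w - h * im v w) +
     h * ((re v u + re z w - h * re v w) ^+ 2 +
          (im v u + im z w - h * im v w) ^+ 2)).
Proof. by rewrite /cross !formE; ring. Qed.

Lemma defectB z v (h : R) :
  defect (z - h%:C *: v) = defect z + h * (2 * re v z - h * sq v).
Proof. by rewrite /defect /sq !formE (re_sym dot z v); ring. Qed.

(** Divide by h the difference of the two sides of the hypothesis and let h tend
    to 0. The asymmetry is deliberate: weak convergence of u_ suffices as long as
    z_ and v_ converge strongly, because u_ enters only through inner products
    with them and through the limits mu and om. When u_ converges only weakly, mu
    may exceed sq u. *)
Lemma first_order (F : set_system R) (FF : ProperFilter F)
    (z_ v_ u_ w_ : R -> H) z v u w (mu om : R) :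
  (h : R) @[h --> F] --> (0 : R) -> (\forall h \near F, 0 < h) ->
  sq (z_ h - z) @[h --> F] --> (0 : R) -> sq (v_ h - v) @[h --> F] --> (0 : R) ->
  weakly dot F u_ u -> weakly dot F w_ w ->
  sq (u_ h) @[h --> F] --> mu -> re (w_ h) (u_ h) @[h --> F] --> om ->
  (\forall h \near F,
    cross (z_ h - h%:C *: v_ h) (u_ h - h%:C *: w_ h) *
      (defect (z_ h) * defect (u_ h)) <=
    cross (z_ h) (u_ h) *
      (defect (z_ h - h%:C *: v_ h) * defect (u_ h - h%:C *: w_ h))) ->
  dcross z u v w * defect z * (1 - mu) <=
  cross z u * (2 * re v z * (1 - mu) + defect z * (2 * om)).
Proof.
move=> h0 hpos zl vl ul wl mul oml ineq.
have zl' : weakly dot F z_ z by exact: strong_weakly.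
have hw : h * sq (w_ h) @[h --> F] --> (0 : R).
  have [[C hC] _] := wl.
  apply: (@squeeze_cvgr _ _ _ _ (fun=> 0) (fun h => h * C)).
  - apply: filterS2 hpos hC => h hp hC.
    by rewrite ler_pM2l // hC mulr_ge0 ?(ltW hp) ?sq_ge0.
  - exact: cvg_cst.
  - by rewrite -[X in _ --> X](mul0r C); cvg_form.
pose X h := re (v_ h) (u_ h) + re (z_ h) (w_ h) - h * re (v_ h) (w_ h).
pose Y h := im (v_ h) (u_ h) + im (z_ h) (w_ h) - h * im (v_ h) (w_ h).
have Xl : X h @[h --> F] --> re v u + re z w - 0 * re v w by rewrite /X; cvg_form.
have Yl : Y h @[h --> F] --> im v u + im z w - 0 * im v w by rewrite /Y; cvg_form.
rewrite !mul0r !subr0 in Xl Yl.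
pose P h := 2 * (1 - re (z_ h) (u_ h)) * X h - 2 * im (z_ h) (u_ h) * Y h +
  h * (X h * X h + Y h * Y h).
have Pl : P h @[h --> F] --> dcross z u v w +
   0 * ((re v u + re z w) * (re v u + re z w) + (im v u + im z w) * (im v u + im z w)).
  by rewrite /P /dcross; cvg_form.
rewrite mul0r addr0 in Pl.
pose m h := 2 * re (v_ h) (z_ h) - h * sq (v_ h).
have ml : m h @[h --> F] --> 2 * re v z - 0 * sq v by rewrite /m; cvg_form.
rewrite mul0r subr0 in ml.
pose d h := 2 * re (w_ h) (u_ h) - h * sq (w_ h).
have dl : d h @[h --> F] --> 2 * om - 0 by rewrite /d; cvg_form.
rewrite subr0 in dl.
pose N h := (1 - re (z_ h) (u_ h)) * (1 - re (z_ h) (u_ h)) +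
  im (z_ h) (u_ h) * im (z_ h) (u_ h).
have Nl : N h @[h --> F] --> (1 - re z u) * (1 - re z u) + im z u * im z u.
  by rewrite /N; cvg_form.
(* E h is the difference of the two sides of the inequality divided by h *)
pose E h := P h * (1 - sq (z_ h)) * (1 - sq (u_ h)) -
  N h * (m h * (1 - sq (u_ h)) + (1 - sq (z_ h)) * d h + h * (m h * d h)).
have El : E h @[h --> F] --> dcross z u v w * (1 - sq z) * (1 - mu) -
  ((1 - re z u) * (1 - re z u) + im z u * im z u) *
   (2 * re v z * (1 - mu) + (1 - sq z) * (2 * om) + 0 * (2 * re v z * (2 * om))).
  by rewrite /E; cvg_form.
have := cvg_le0 El _.
rewrite mul0r addr0 subr_le0 -!expr2; apply.
apply: filterS2 hpos ineq => h hp.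
rewrite crossB !defectB -subr_le0.
set lhs := (X in X <= 0 -> _).
have -> : lhs = h * E h.
  by rewrite /lhs /E /P /N /X /Y /m /d /cross /defect; ring.
by rewrite pmulr_rle0.
Qed.

(** The tangent k of half the argument of b1 + i b2 gives a rational
    parametrization of its modulus, r (1 + k ^ 2). *)
Lemma half_angle (b1 b2 : R) : 0 < b1 ->
  exists r k : R, [/\ 0 < r, b1 = r * (1 - k ^+ 2) & b2 = 2 * r * k].
Proof.
move=> b10; pose n := Num.sqrt (b1 ^+ 2 + b2 ^+ 2).
have n0 : 0 <= n by exact: sqrtr_ge0.
have n2 : n ^+ 2 = b1 ^+ 2 + b2 ^+ 2.
  by rewrite sqr_sqrtr // addr_ge0 // sqr_ge0.
have s0 : n + b1 != 0 by rewrite gt_eqF // ltr_wpDl.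
exists ((n + b1) / 2), (b2 / (n + b1)); split.
- by rewrite divr_gt0 // ltr_wpDl.
- apply: (mulIf s0); apply: (mulIf (x := 2)) => //.
  have -> : (n + b1) / 2 * (1 - (b2 / (n + b1)) ^+ 2) * (n + b1) * 2 =
    (n + b1) ^+ 2 - b2 ^+ 2 by field.
  have -> : b2 ^+ 2 = n ^+ 2 - b1 ^+ 2 by rewrite n2; ring.
  by ring.
- by field.
Qed.

Definition horo u z : R := cross z u / defect z.

(** Let c be half the modulus of b = 1 - <x, y> and k the tangent of half the
    argument of b. The sum of the two quadratic functions
    |1 - <z, x>|^2 - c (1 - |z|^2) and |1 - <z, y>|^2 - c (1 - |z|^2) is strictly
    convex with minimum 0, attained at p = ((1 - i k) x + (1 + i k) y) / 2 only;
    both summands vanish at p, so that the horoballs of level c at x and y have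
    only p in common. *)
Lemma horoballs_touch x y : sq x = 1 -> sq y = 1 -> x != y ->
  exists2 p, sq p < 1 & forall z, sq z < 1 ->
    horo x z <= horo x p -> horo y z <= horo y p -> z = p.
Proof.
move=> x1 y1 xy.
have b1 : 0 < 1 - re x y.
  rewrite ltNge; apply: contra xy => b1; apply/eqP/(sq_subr0_eq dotE).
  move: x1 y1; rewrite /sq !formE (re_sym dot y x) => -> ->; lra.
have [r [k [r0 pE qE]]] := half_angle (- im x y) b1.
pose p := (2^-1)%:C *: (x + y) - (k / 2)%:C *: ('i%C *: (x - y)).
have xyE : re x y = 1 - r * (1 - k ^+ 2) by lra.
have ixyE : im x y = - (2 * r * k) by lra.
have formxy := (re_sym dot y x, im_asym dot y x, xyE, ixyE).
rewrite /sq in x1 y1.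
pose t := 1 + k ^+ 2.
have t0 : 0 < t by rewrite ltr_pwDl // sqr_ge0.
have dp : defect p = r * t ^+ 2 / 2.
  by rewrite /defect /sq /p /t !formE !formxy x1 y1; field.
have cx : cross p x = r ^+ 2 * t ^+ 3 / 4.
  by rewrite /cross /p /t !formE !formxy x1; field.
have cy : cross p y = r ^+ 2 * t ^+ 3 / 4.
  by rewrite /cross /p /t !formE !formxy y1; field.
have dp0 : 0 < defect p by rewrite dp divr_gt0 // mulr_gt0 // exprn_gt0.
exists p; first by rewrite -subr_gt0.
move=> z z1; have dz0 : 0 < defect z by rewrite subr_gt0.
have hp : r ^+ 2 * t ^+ 3 / 4 / (r * t ^+ 2 / 2) = r * t / 2.
  by field; rewrite !gt_eqF.
rewrite /horo cx cy dp hp !ler_pdivrMr // => hx hy.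
have zE : z = p + (z - p) by rewrite addrC subrK.
move: hx hy; move: (z - p) zE => y' zE hx hy.
suff : y' = 0 by rewrite zE => ->; rewrite addr0.
apply: (sq_eq0 dotE).
have : cross z x + cross z y - r * t * defect z <= 0 by lra.
have -> : cross z x + cross z y - r * t * defect z =
  re y' x ^+ 2 + im y' x ^+ 2 + re y' y ^+ 2 + im y' y ^+ 2 + r * t * sq y'.
  rewrite zE /cross /defect /sq /p /t !formE.
  rewrite (re_sym dot x y') (re_sym dot y y') (im_asym dot x y') (im_asym dot y y').
  by rewrite !formxy x1 y1; field.
have := sqr_ge0 (re y' x); have := sqr_ge0 (re y' y).
have := sqr_ge0 (im y' x); have := sqr_ge0 (im y' y).
move=> h1 h2 h3 h4 h5; rewrite -(pmulr_rle0 _ (mulr_gt0 r0 t0)).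
by lra.
Qed.

Lemma horo_rate (v_ : R -> H) z u v : sq z < 1 ->
  sq (v_ h - v) @[h --> (0 : R)^'+] --> (0 : R) ->
  (\forall h \near (0 : R)^'+, sq (z - h%:C *: v_ h) < 1) ->
  (horo u (z - h%:C *: v_ h) - horo u z) / h @[h --> (0 : R)^'+] -->
  (dcross z u v 0 * defect z - cross z u * (2 * re v z)) / defect z ^+ 2.
Proof.
move=> z1 vl near1.
have M0 : 0 < defect z by rewrite subr_gt0.
have h0 : (h : R) @[h --> (0 : R)^'+] --> (0 : R).
  by apply: cvg_at_right_filter; exact: cvg_id.
have cw x : weakly dot (0 : R)^'+ (fun=> x) x.
  by split; [exists (sq x); near=> h | move=> y; apply: cvg_cst].
have cu := cw u; have cz := cw z.
pose P h := 2 * (1 - re z u) * re (v_ h) u - 2 * im z u * im (v_ h) u +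
  h * (re (v_ h) u * re (v_ h) u + im (v_ h) u * im (v_ h) u).
have Pl : P h @[h --> (0 : R)^'+] -->
   2 * (1 - re z u) * re v u - 2 * im z u * im v u +
   0 * (re v u * re v u + im v u * im v u) by rewrite /P; cvg_form.
pose m h := 2 * re (v_ h) z - h * sq (v_ h).
have ml : m h @[h --> (0 : R)^'+] --> 2 * re v z - 0 * sq v by rewrite /m; cvg_form.
rewrite mul0r addr0 in Pl; rewrite mul0r subr0 in ml.
have Ml : ((defect z + h * m h) * defect z)^-1 @[h --> (0 : R)^'+] -->
   ((defect z + 0 * (2 * re v z)) * defect z)^-1.
  apply: cvgV; first by rewrite mul0r addr0 mulf_neq0 // gt_eqF.
  by cvg_form.
rewrite mul0r addr0 -expr2 in Ml.
have -> : dcross z u v 0 = 2 * (1 - re z u) * re v u - 2 * im z u * im v u.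
  by rewrite /dcross !formE !addr0.
have El : (P h * defect z - cross z u * m h) *
    ((defect z + h * m h) * defect z)^-1 @[h --> (0 : R)^'+] -->
   ((2 * (1 - re z u) * re v u - 2 * im z u * im v u) * defect z -
   cross z u * (2 * re v z)) / defect z ^+ 2 by cvg_form.
apply: cvg_trans El; apply: near_eq_cvg; near=> h.
have hp : 0 < h by near: h; exact: nbhs_right_gt.
have : 0 < defect (z - h%:C *: v_ h) by rewrite subr_gt0; near: h.
have := crossB z u (v_ h) 0 h; rewrite scaler0 subr0 /horo => ->.
rewrite /P defectB -/(m h) !formE => d0.
by field; rewrite !gt_eqF.
Unshelve. all: by end_near. Qed.
End FirstOrder.

(** * Horofunctions along orbits *)

Section Flow.
Context (R : realType) (H : completeNormedModType R[i]).
Variable dot : {dot H for Num.conj}.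
Hypothesis dotE : norm_from_dot dot.
Variables (F : R -> H -> H) (f : H -> H).
Hypothesis semigroupF : continuous_semigroup F.
Hypothesis nonexpF : forall t : R, 0 <= t -> rho_nonexpansive dot (F t).
Hypothesis genF : generated_by F f.
Implicit Types (x y z u v w : H) (a b c : R).
Local Notation re := (re dot).
Local Notation im := (im dot).
Local Notation sq := (sq dot).
Local Notation defect := (defect dot).
Local Notation cross := (cross dot).
Local Notation horo := (horo dot).
Local Notation dcross := (dcross dot).

Lemma flow_ball t z : 0 <= t -> sq z < 1 -> sq (F t z) < 1.
Proof.
have [FB _ _] := semigroupF.
by move=> t0 z1; apply/(ballE dotE)/FB => //; apply/ballE.
Qed.

Lemma flow_add t s z : 0 <= t -> 0 <= s -> sq z < 1 -> F (t + s) z = F t (F s z).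
Proof. by have [_ FA _] := semigroupF => t0 s0 z1; apply: FA => //; apply/ballE. Qed.

Lemma flow_schwarz_pick t : 0 <= t -> schwarz_pick dot (F t).
Proof.
move=> t0; apply: rho_schwarz_pick => // [x|]; first exact: flow_ball.
exact: nonexpF.
Qed.

Definition vel (h : R) z : H := h^-1%:C *: (z - F h z).

Lemma flow_vel h z : 0 < h -> F h z = z - h%:C *: vel h z.
Proof.
move=> h0; rewrite /vel scalerA -rmorphM /= divff ?gt_eqF // scale1r.
by rewrite opprB addrC subrK.
Qed.

Lemma vel_cvg z : sq z < 1 -> sq (vel h z - f z) @[h --> (0 : R)^'+] --> (0 : R).
Proof. by move=> /(ballE dotE)/genF/(cvg_sqP dotE). Qed.

Lemma flow_right z : sq z < 1 -> sq (F h z - z) @[h --> (0 : R)^'+] --> (0 : R).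
Proof.
have [_ _ FC] := semigroupF.
by move=> /(ballE dotE)/FC/(cvg_sqP dotE).
Qed.

Lemma flow0 z : sq z < 1 -> F 0 z = z.
Proof.
move=> z1; apply: (sq_cvg_uniq dotE) (flow_right z1).
apply: cvg_trans (flow_right (flow_ball (lexx 0) z1)).
apply: near_eq_cvg; near=> h.
have h0 : 0 < h by near: h; exact: nbhs_right_gt.
by rewrite -flow_add ?addr0 // ltW.
Unshelve. all: by end_near. Qed.

Lemma cvg_horo (T : Type) (G : set_system T) {GG : Filter G} (g : T -> H) u z :
  sq z < 1 -> sq (g t - z) @[t --> G] --> (0 : R) ->
  horo u (g t) @[t --> G] --> horo u z.
Proof.
move=> z1 gz.
have cu : weakly dot G (fun=> u) u.
  by split; [exists (sq u); near=> h | move=> y; apply: cvg_cst].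
have Mi : (1 - sq (g t))^-1 @[t --> G] --> (1 - sq z)^-1.
  by apply: cvgV; [rewrite gt_eqF // subr_gt0 | cvg_form].
have hE x : horo u x =
    ((1 - re x u) * (1 - re x u) + im x u * im x u) * (1 - sq x)^-1.
  by rewrite /horo /cross !expr2.
by rewrite hE (eq_fun (fun t => hE (g t))); cvg_form.
Unshelve. all: by end_near. Qed.

(** F_s z = F_(s - h) (F_h z), so the distance between F_(s - h) z and F_s z is
    controlled by that between z and F_h z. *)
Lemma flow_left s z : 0 < s -> sq z < 1 ->
  sq (F (s - h) z - F s z) @[h --> (0 : R)^'+] --> (0 : R).
Proof.
move=> s0 z1.
have M0 : 0 < defect z by rewrite subr_gt0.
have sF := flow_right z1; have dF := cvg_sq dotE sF.
have L : sq (F h z - z) * ((1 - sq z) * (1 - sq (F h z)))^-1 @[h --> (0 : R)^'+]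
    --> 0 * ((1 - sq z) * (1 - sq z))^-1.
  apply: cvgM => //; apply: cvgV; first by rewrite mulf_neq0 // gt_eqF.
  by cvg_form.
rewrite mul0r in L; apply: squeeze_cvgr (cvg_cst 0) L; near=> h.
have h0 : 0 < h by near: h; exact: nbhs_right_gt.
have hs : h < s by near: h; exact: nbhs_right_lt.
have sh : 0 <= s - h by rewrite subr_ge0 ltW.
rewrite sq_ge0 //= ler_pdivlMr; last first.
  by rewrite mulr_gt0 // subr_gt0 flow_ball // ltW.
have -> : F s z = F (s - h) (F h z) by rewrite -flow_add ?subrK ?(ltW h0).
rewrite (sqC _ (F h z)).
apply: schwarz_pick_sq => //; last by apply: flow_ball => //; exact: ltW.
  by move=> x; apply: flow_ball.
exact: flow_schwarz_pick.
Unshelve. all: by end_near. Qed.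

(** The derivative of [horo u] along the orbit of z at z, times
    [defect z ^+ 2]. *)
Definition rate z u : R :=
  dcross z u (f z) 0 * defect z - cross z u * (2 * re (f z) z).

(** The quadratic majorant is what [curve_speed] needs: there, the derivative of
    [horo u] along the orbit vanishes at time 0 and the second order matters. *)
Lemma horo_flow z u (T b c : R) : sq z < 1 -> 0 < T ->
  (forall s : R, 0 <= s < T ->
     rate (F s z) u <= (b + 2 * c * s) * defect (F s z) ^+ 2) ->
  horo u (F T z) <= horo u z + b * T + c * T ^+ 2.
Proof.
move=> z1 T0 hr.
suff : horo u (F T z) - (b * T + c * T ^+ 2) <= horo u (F 0 z) - (b * 0 + c * 0 ^+ 2).
  by rewrite flow0 //; lra.
apply: (nonincreasing_dini (g := fun s => horo u (F s z) - (b * s + c * s ^+ 2))) => // s.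
  move=> /andP[s0 sT]; apply: cvgB.
    by apply: cvg_horo (flow_left s0 z1); rewrite flow_ball // ltW.
  have h0 : (h : R) @[h --> (0 : R)^'+] --> (0 : R).
    by apply: cvg_at_right_filter; exact: cvg_id.
  have -> : b * s + c * s ^+ 2 = b * (s - 0) + c * ((s - 0) * (s - 0)) by ring.
  have -> : (fun h => b * (s - h) + c * (s - h) ^+ 2) =
    (fun h => b * (s - h) + c * ((s - h) * (s - h))).
    by apply/funext => h; rewrite expr2.
  by cvg_form.
move=> e sT e0; have /andP[s0 _] := sT.
have Fs1 : sq (F s z) < 1 by exact: flow_ball.
have M0 : 0 < defect (F s z) by rewrite subr_gt0.
have vb : \forall h \near (0 : R)^'+, sq (F s z - h%:C *: vel h (F s z)) < 1.
  near=> h; have h0 : 0 < h by near: h; exact: nbhs_right_gt.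
  by rewrite -flow_vel // flow_ball // ltW.
have hl := horo_rate dotE (u := u) Fs1 (vel_cvg Fs1) vb.
have rb : (dcross (F s z) u (f (F s z)) 0 * defect (F s z) -
   cross (F s z) u * (2 * re (f (F s z)) (F s z))) / defect (F s z) ^+ 2 <
   b + 2 * c * s + e / 2.
  apply: (@le_lt_trans _ _ (b + 2 * c * s)); last lra.
  by rewrite ler_pdivrMr ?exprn_gt0 //; exact: hr.
have {}hl := cvgr_le _ hl _ rb.
have hc : \forall h \near (0 : R)^'+, - c * h <= e / 2.
  have [c0|c0] := leP 0 c.
    near=> h; have h0 : 0 < h by near: h; exact: nbhs_right_gt.
    by nra.
  have nc : 0 < - c by rewrite oppr_gt0.
  have ec : 0 < e / 2 / - c by rewrite divr_gt0 // divr_gt0.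
  near=> h; have he : h < e / 2 / - c by near: h; exact: nbhs_right_lt.
  by move: he; rewrite ltr_pdivlMr // mulrC => /ltW.
near=> h.
have h0 : 0 < h by near: h; exact: nbhs_right_gt.
have : (horo u (F s z - h%:C *: vel h (F s z)) - horo u (F s z)) / h <= b + 2 * c * s + e / 2.
  by near: h; exact: hl.
rewrite -flow_vel // ler_pdivrMr // -flow_add // ?(ltW h0) // (addrC h).
have ch : - c * h <= e / 2 by near: h; exact: hc.
by nra.
Unshelve. all: by end_near. Qed.

Lemma horo_flow_mono z u t : (forall y, sq y < 1 -> rate y u <= 0) ->
  sq z < 1 -> 0 <= t -> horo u (F t z) <= horo u z.
Proof.
move=> hr z1; rewrite le_eqVlt => /orP[/eqP <-|t0]; first by rewrite flow0.
have := @horo_flow z u t 0 0 z1 t0.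
rewrite !mul0r !addr0; apply => s /andP[s0 _].
by rewrite mulr0 add0r !mul0r hr // flow_ball.
Qed.

Lemma horo_self u : sq u < 1 -> horo u u = defect u.
Proof.
move=> u1; have M0 : 0 < defect u by rewrite subr_gt0.
rewrite /horo /cross imxx expr0n addr0 -/(sq u) -/(defect u).
by rewrite expr2 mulfK // gt_eqF.
Qed.

(** horo u (F_t u) <= horo u u means K(F_t u, u) <= 1. *)
Lemma stationary_of_rate u : sq u < 1 -> (forall y, sq y < 1 -> rate y u <= 0) ->
  forall t, 0 <= t -> F t u = u.
Proof.
move=> u1 hr t t0; apply: (sq_subr0_eq dotE).
have M0 : 0 < defect u by rewrite subr_gt0.
have Ft : 0 < defect (F t u) by rewrite subr_gt0 flow_ball.
have := horo_flow_mono hr u1 t0; rewrite horo_self // ler_pdivrMr // => h.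
have := excess_ge_sq dotE (F t u) u; rewrite /excess => h'.
rewrite -(pmulr_lle0 _ M0); lra.
Qed.

(** Hyperbolic monotonicity of the generator. *)
Lemma pair_rate z y : sq z < 1 -> sq y < 1 ->
  dcross z y (f z) (f y) * defect z * defect y <=
  cross z y * (2 * re (f z) z * defect y + defect z * (2 * re (f y) y)).
Proof.
move=> z1 y1.
have strong0 x : sq (x - x) @[_ --> (0 : R)^'+] --> (0 : R).
  by rewrite subrr /sq formE; apply: cvg_cst.
have cy : weakly dot (0 : R)^'+ (fun=> y) y by apply: strong_weakly.
apply: (@first_order R H dot dotE (0 : R)^'+ _ (fun=> z) (vel ^~ z) (fun=> y) (vel ^~ y)) => //.
- by apply: cvg_at_right_filter; exact: cvg_id.
- exact: nbhs_right_gt.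
- exact: vel_cvg.
- by apply: strong_weakly => //; apply: vel_cvg.
- exact: cvg_cst.
- by apply: cvg_re => //; apply: vel_cvg.
near=> h; have h0 : 0 < h by near: h; exact: nbhs_right_gt.
by rewrite -!flow_vel //; apply: flow_schwarz_pick; rewrite // ltW.
Unshelve. all: by end_near. Qed.

Lemma null_stationary x : sq x < 1 -> f x = 0 -> forall t, 0 <= t -> F t x = x.
Proof.
move=> x1 fx; apply: stationary_of_rate => // y y1.
have M0 : 0 < defect x by rewrite subr_gt0.
have := pair_rate y1 x1; rewrite fx !formE !mulr0 addr0 mulrA ler_pM2r //.
by rewrite /rate subr_le0.
Qed.

Lemma stationary_null x : sq x < 1 -> (forall t, 0 <= t -> F t x = x) -> f x = 0.
Proof.
move=> x1 Fx; apply: (sq_cvg_uniq dotE) (vel_cvg x1) _.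
apply: cvg_near_cst; near=> h.
have h0 : 0 < h by near: h; exact: nbhs_right_gt.
by rewrite /vel Fx ?ltW // subrr scaler0 subrr /sq !formE.
Unshelve. all: by end_near. Qed.
End Flow.

(** * Resolvents of the generator *)

Section DiscreteResolvents.
Context (R : realType) (H : completeNormedModType R[i]).
Variable dot : {dot H for Num.conj}.
Hypothesis dotE : norm_from_dot dot.
Variables (F : R -> H -> H) (f : H -> H).
Hypothesis semigroupF : continuous_semigroup F.
Hypothesis nonexpF : forall t : R, 0 <= t -> rho_nonexpansive dot (F t).
Hypothesis genF : generated_by F f.
Implicit Types (x y z u v w : H) (a b c : R).
Local Notation re := (re dot).
Local Notation im := (im dot).
Local Notation sq := (sq dot).
Local Notation defect := (defect dot).
Local Notation cross := (cross dot).
Local Notation dcross := (dcross dot).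
Local Notation rate := (rate dot f).
Local Notation vel := (vel F).

(** p is a zero of (id - F_h) / h + e id, that is, a fixed point of
    (1 + e h)^-1 F_h. *)
Lemma discrete_resolvent (e h : R) : 0 < e -> 0 < h ->
  exists2 p, sq p < 1 & F h p = p - h%:C *: ((- e)%:C *: p).
Proof.
move=> e0 h0; have eh : 0 < e * h by exact: mulr_gt0.
have k0 : 0 < 1 + e * h by rewrite addr_gt0.
have r01 : 0 < (1 + e * h)^-1 < 1.
  by rewrite invr_gt0 k0 invf_lt1 // ltrDl.
have FB : forall x, sq x < 1 -> sq (F h x) < 1.
  by move=> x; apply: (flow_ball dotE semigroupF); exact: ltW.
have [p p1 pE] := dilation_fixpoint dotE FB
  (flow_schwarz_pick dotE semigroupF nonexpF (ltW h0)) r01.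
exists p => //; rewrite scalerA -rmorphM /= -[X in X - _]scale1r -scalerBl.
rewrite -[1 in RHS]/((1 : R)%:C) -rmorphB /= {2}pE scalerA -rmorphM /=.
have -> : (1 - h * - e) / (1 + e * h) = 1 by field; rewrite gt_eqF.
by rewrite scale1r.
Qed.

Section Resolvent.
(* The discrete resolvents g e h are studied along an ultrafilter of h > 0. *)
Variables (U : set_system R) (UU : UltraFilter U).
Hypothesis U0 : (0 : R)^'+ `<=` U.

Lemma ultra_right (P : R -> Prop) :
  (\forall h \near (0 : R)^'+, P h) -> \forall h \near U, P h.
Proof. exact: U0. Qed.

Lemma ultra_cvg0 : (h : R) @[h --> U] --> (0 : R).
Proof.
apply: cvg_trans (_ : (h : R) @[h --> (0 : R)^'+] --> (0 : R)).
  by move=> A; exact: U0.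
by apply: cvg_at_right_filter; exact: cvg_id.
Qed.

Lemma ultra_sub (V : topologicalType) (g : R -> V) (l : V) :
  g h @[h --> (0 : R)^'+] --> l -> g h @[h --> U] --> l.
Proof. by move=> gl; apply: cvg_trans gl => A; exact: U0. Qed.

Variable g : R -> R -> H.
Hypothesis gP : forall e h : R, 0 < e -> 0 < h ->
  sq (g e h) < 1 /\ F h (g e h) = g e h - h%:C *: ((- e)%:C *: g e h).

Lemma near_pos : \forall h \near U, 0 < h.
Proof. by apply: ultra_right; exact: nbhs_right_gt. Qed.

Lemma resolvent_first_order (e mu : R) u (z_ v_ : R -> H) z v : 0 < e ->
  weakly dot U (g e) u -> sq (g e h) @[h --> U] --> mu ->
  sq (z_ h - z) @[h --> U] --> (0 : R) -> sq (v_ h - v) @[h --> U] --> (0 : R) ->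
  (\forall h \near U, sq (z_ h) < 1 /\ F h (z_ h) = z_ h - h%:C *: v_ h) ->
  dcross z u v ((- e)%:C *: u) * defect z * (1 - mu) <=
  cross z u * (2 * re v z * (1 - mu) + defect z * (2 * (- e * mu))).
Proof.
move=> e0 wu mul zl vl Fz; have hpos := near_pos.
apply: (@first_order R H dot dotE U _ z_ v_ (g e)
  (fun h => (- e)%:C *: g e h)) => //.
- exact: ultra_cvg0.
- exact: weaklyZ.
- have -> : (fun h => re ((- e)%:C *: g e h) (g e h)) = (fun h => - e * sq (g e h)).
    by apply/funext => h; rewrite reZl.
  by apply: cvgM => //; exact: cvg_cst.
- apply: filterS2 hpos Fz => h h0 [z1 <-]; have [gh1 <-] := gP e0 h0.
  by apply: (flow_schwarz_pick dotE semigroupF nonexpF (ltW h0)).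
Qed.

Lemma near_vel z : sq z < 1 ->
  \forall h \near U, sq z < 1 /\ F h z = z - h%:C *: vel h z.
Proof. by move=> z1; apply: filterS near_pos => h h0; rewrite -flow_vel. Qed.

(** With u the weak limit and mu the limit of sq (g e h), the first order
    inequality tested at 0 gives mu < 1, and tested at u it gives mu <= sq u,
    because there the contributions of f u cancel. Weak convergence with
    convergence of norms is strong. *)
Lemma resolvent_limit (e : R) : 0 < e ->
  exists2 u, sq u < 1 & sq (g e h - u) @[h --> U] --> (0 : R).
Proof.
move=> e0.
have hpos := near_pos.
have g1 : \forall h \near U, sq (g e h) < 1.
  by apply: filterS hpos => h h0; have [] := gP e0 h0.
have [u wu] : exists u, weakly dot U (g e) u.
  by apply: (weak_limit dotE (C := 1)); apply: filterS g1 => h /ltW.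
have [mu muE] : exists mu : R, sq (g e h) @[h --> U] --> mu.
  apply: (@ultra_cvg _ _ _ UU _ 1); apply: filterS g1 => h h1.
  by have := sq_ge0 dotE (g e h); lra.
have mu1 : mu <= 1.
  rewrite -subr_le0; apply: (@cvg_le0 _ _ U _ (fun h => sq (g e h) - 1)).
    by apply: cvgB => //; exact: cvg_cst.
  by apply: filterS g1 => h h1; rewrite subr_le0 ltW.
have sul : sq (g e h - u) @[h --> U] --> mu - sq u.
  have -> : mu - sq u = mu - 2 * re u u + sq u by rewrite /sq; ring.
  have -> : (fun h => sq (g e h - u)) = (fun h => sq (g e h) - 2 * re (g e h) u + sq u).
    by apply/funext => h; rewrite /sq !formE (re_sym dot u); ring.
  have wuu := wu.2 u.
  apply: cvgD; last exact: cvg_cst.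
  by apply: cvgB => //; apply: cvgM => //; exact: cvg_cst.
have umu : sq u <= mu.
  rewrite -subr_le0 -opprB.
  apply: (@cvg_le0 _ _ U _ (fun h => - sq (g e h - u))); first exact: cvgN.
  by near=> h; rewrite oppr_le0 sq_ge0.
have test z : sq z < 1 ->
  dcross z u (f z) ((- e)%:C *: u) * defect z * (1 - mu) <=
  cross z u * (2 * re (f z) z * (1 - mu) + defect z * (2 * (- e * mu))).
  move=> z1; apply: (resolvent_first_order (z_ := fun=> z) (v_ := vel ^~ z)) => //.
  - by rewrite subrr /sq formE; apply: cvg_cst.
  - by apply: ultra_sub; exact: vel_cvg.
  - exact: near_vel.
have mu_lt1 : mu < 1.
  rewrite lt_neqAle mu1 andbT; apply/eqP => mu_eq.
  have := test 0; rewrite mu_eq subrr !mulr0 add0r /defect /cross /sq !formE.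
  by move=> /(_ ltr01); rewrite subr0 expr1n expr0n /=; lra.
have u1 : sq u < 1 by apply: le_lt_trans mu_lt1.
exists u => //.
suff -> : 0 = mu - sq u by [].
apply/esym/eqP; rewrite subr_eq0 eq_le umu andbT.
have M0 : 0 < defect u by rewrite subr_gt0.
have := test u u1.
rewrite /dcross /cross !formE /= -!/(sq u) -!/(defect u).
have sE : sq u = 1 - defect u by rewrite /defect; ring.
rewrite sE; move: (defect u) M0 (re (f u) u) => M M0 t h.
have : 2 * e * M ^+ 2 * (mu - (1 - M)) <= 0 by lra.
by rewrite pmulr_rle0 ?subr_le0 // mulr_gt0 ?exprn_gt0 // mulr_gt0.
Unshelve. all: by end_near. Qed.

Lemma resolvent_rate (e : R) u z : 0 < e -> sq u < 1 -> sq z < 1 ->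
  sq (g e h - u) @[h --> U] --> (0 : R) ->
  rate z u * defect u <= 2 * e * defect z * ((1 - re z u) * defect u - cross z u).
Proof.
move=> e0 u1 z1 ul.
have : dcross z u (f z) ((- e)%:C *: u) * defect z * (1 - sq u) <=
  cross z u * (2 * re (f z) z * (1 - sq u) + defect z * (2 * (- e * sq u))).
  apply: (resolvent_first_order (z_ := fun=> z) (v_ := vel ^~ z)) => //.
  - exact: strong_weakly.
  - exact: cvg_sq.
  - by rewrite subrr /sq formE; apply: cvg_cst.
  - by apply: ultra_sub; exact: vel_cvg.
  - exact: near_vel.
rewrite /rate /dcross /cross !formE !addr0 /defect.
by lra.
Qed.

Lemma resolvent_pair (e d : R) u y : 0 < e -> 0 < d -> sq u < 1 -> sq y < 1 ->
  sq (g e h - u) @[h --> U] --> (0 : R) ->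
  sq (g d h - y) @[h --> U] --> (0 : R) ->
  cross y u * (d * defect u + e * defect y) <=
  (d + e) * (1 - re y u) * defect y * defect u.
Proof.
move=> e0 d0 u1 y1 ul yl.
have : dcross y u ((- d)%:C *: y) ((- e)%:C *: u) * defect y * (1 - sq u) <=
  cross y u * (2 * re ((- d)%:C *: y) y * (1 - sq u) + defect y * (2 * (- e * sq u))).
  apply: (resolvent_first_order (z_ := g d) (v_ := fun h => (- d)%:C *: g d h)) => //.
  - exact: strong_weakly.
  - exact: cvg_sq.
  - have -> : (fun h => sq ((- d)%:C *: g d h - (- d)%:C *: y)) =
        (fun h => (- d) ^+ 2 * sq (g d h - y)).
      by apply/funext => h; rewrite -scalerBr sqZ.
    by rewrite -[X in _ --> X](mulr0 ((- d) ^+ 2)); apply: cvgM => //; exact: cvg_cst.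
  - by apply: filterS near_pos => h; exact: gP.
rewrite /dcross /cross !formE -/(sq y) /defect.
by lra.
Qed.
End Resolvent.

(** The second and third clauses are [first_order] for the pair (u_e, - e u_e)
    against the pairs (z, f z) and (u_d, - d u_d). They express the monotonicity
    of a graph that contains the graph of f and these pairs. *)
Lemma resolvents : exists u : R -> H, [/\
  forall e : R, 0 < e -> sq (u e) < 1,
  forall (e : R) z, 0 < e -> sq z < 1 ->
    rate z (u e) * defect (u e) <=
    2 * e * defect z * ((1 - re z (u e)) * defect (u e) - cross z (u e))
  & forall e d : R, 0 < e -> 0 < d ->
    cross (u d) (u e) * (d * defect (u e) + e * defect (u d)) <=
    (d + e) * (1 - re (u d) (u e)) * defect (u d) * defect (u e)].
Proof.
have [U [UU U0]] := ultraFilterLemma (at_right_proper_filter (0 : R)).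
have [g0 gP0] : {g0 : R * R -> H & forall p : R * R, 0 < p.1 -> 0 < p.2 ->
   sq (g0 p) < 1 /\ F p.2 (g0 p) = g0 p - p.2%:C *: ((- p.1)%:C *: g0 p)}.
  apply: (@choice _ _ (fun (p : R * R) x => 0 < p.1 -> 0 < p.2 ->
    sq x < 1 /\ F p.2 x = x - p.2%:C *: ((- p.1)%:C *: x))) => -[e h] /=.
  have [e0|e0] := ltP 0 e; last by exists 0.
  have [h0|h0] := ltP 0 h; last by exists 0.
  by have [p p1 pE] := discrete_resolvent e0 h0; exists p.
pose g e h := g0 (e, h).
have gP e h : 0 < e -> 0 < h ->
  sq (g e h) < 1 /\ F h (g e h) = g e h - h%:C *: ((- e)%:C *: g e h).
  by move=> e0 h0; apply: (gP0 (e, h)).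
have [u uP] : {u : R -> H & forall e : R, 0 < e ->
    sq (u e) < 1 /\ sq (g e h - u e) @[h --> U] --> (0 : R)}.
  apply: (@choice _ _ (fun (e : R) u => 0 < e ->
    sq u < 1 /\ sq (g e h - u) @[h --> U] --> (0 : R))) => e.
  have [e0|e0] := ltP 0 e; last by exists 0.
  by have [u u1 ul] := resolvent_limit UU U0 gP e0; exists u.
exists u; split=> [e e0|e z e0 z1|e d e0 d0].
- by have [] := uP e e0.
- by have [u1 ul] := uP e e0; apply: (resolvent_rate UU U0 gP).
- have [u1 ul] := uP e e0; have [y1 yl] := uP d d0.
  exact: (resolvent_pair UU U0 gP).
Qed.
End DiscreteResolvents.

(** * The curve of resolvents and its end point *)

Section ResolventCurve.
Context (R : realType) (H : completeNormedModType R[i]).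
Variable dot : {dot H for Num.conj}.
Hypothesis dotE : norm_from_dot dot.
Variables (F : R -> H -> H) (f : H -> H).
Hypothesis semigroupF : continuous_semigroup F.
Hypothesis nonexpF : forall t : R, 0 <= t -> rho_nonexpansive dot (F t).
Hypothesis genF : generated_by F f.
Implicit Types (x y z u v w : H) (a b c : R).
Local Notation re := (re dot).
Local Notation im := (im dot).
Local Notation sq := (sq dot).
Local Notation defect := (defect dot).
Local Notation cross := (cross dot).
Local Notation horo := (horo dot).
Local Notation dcross := (dcross dot).
Local Notation rate := (rate dot f).
Local Notation vel := (vel F).

Variable u : R -> H.
Hypothesis u1 : forall e : R, 0 < e -> sq (u e) < 1.
Hypothesis u_rate : forall (e : R) z, 0 < e -> sq z < 1 ->
  rate z (u e) * defect (u e) <=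
  2 * e * defect z * ((1 - re z (u e)) * defect (u e) - cross z (u e)).
Hypothesis u_pair : forall e d : R, 0 < e -> 0 < d ->
  cross (u d) (u e) * (d * defect (u e) + e * defect (u d)) <=
  (d + e) * (1 - re (u d) (u e)) * defect (u d) * defect (u e).

Lemma curve_defect_gt0 (e : R) : 0 < e -> 0 < defect (u e).
Proof. by move=> e0; rewrite subr_gt0 u1. Qed.

(** Let M and m be the defects of u_d and u_e, and A = 1 - Re <u_d, u_e>. Since
    M m and A ^ 2 are both at most |1 - <u_d, u_e>|^2, the pair inequality bounds
    d m + e M by (d + e) A and A (d m + e M) by (d + e) M m. Eliminating A gives
    (m - M) (d ^ 2 m - e ^ 2 M) <= 0, whence M <= m as d <= e, and then
    A <= m. *)
Lemma curve_compare (e d : R) : 0 < d -> d <= e ->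
  [/\ defect (u d) <= defect (u e), d ^+ 2 * defect (u e) <= e ^+ 2 * defect (u d)
    & sq (u e - u d) <= defect (u e) - defect (u d)].
Proof.
move=> d0 de; have e0 := lt_le_trans d0 de.
have := u_pair e0 d0; have := excess_ge_sq dotE (u d) (u e).
have m0 := curve_defect_gt0 e0; have M0 := curve_defect_gt0 d0.
have : sq (u e - u d) = 2 * (1 - re (u d) (u e)) - defect (u e) - defect (u d).
  by rewrite /defect /sq !formE (re_sym dot (u e) (u d)); ring.
have := sq_ge0 dotE (u d - u e).
have : (1 - re (u d) (u e)) ^+ 2 <= cross (u d) (u e) by rewrite lerDl sqr_ge0.
rewrite /excess; move: (sq (u e - u d)) (sq (u d - u e)) => s s'.
move: (cross _ _) (1 - re _ _) => N A.
move: (defect (u e)) (defect (u d)) m0 M0 => m M m0 M0 AN s0 -> ex pr.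
have NM : M * m <= N by have : 0 <= s' * m by [rewrite mulr_ge0 // ltW]; lra.
pose S := d * m + e * M.
have S0 : 0 < S by rewrite addr_gt0 ?mulr_gt0.
rewrite -/S in pr.
have Mm0 : 0 < M * m by exact: mulr_gt0.
have SA : S <= (d + e) * A.
  rewrite -(ler_pM2l Mm0); apply: le_trans (ler_wpM2r (ltW S0) NM) _.
  by apply: le_trans pr _; rewrite le_eqVlt; apply/orP; left; apply/eqP; ring.
have de0 : 0 < d + e by rewrite addr_gt0.
have A0 : 0 < A by rewrite -(pmulr_rgt0 _ de0); exact: lt_le_trans SA.
have AS : A * S <= (d + e) * (M * m).
  rewrite -(ler_pM2l A0).
  have := le_trans (ler_wpM2r (ltW S0) AN) pr.
  by move: (S) => S'; lra.
have SS : S ^+ 2 <= (d + e) ^+ 2 * (M * m).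
  have h1 := ler_wpM2r (ltW S0) SA; have h2 := ler_wpM2l (ltW de0) AS.
  by move: (S) h1 h2 => S'; lra.
have prod : (m - M) * (d ^+ 2 * m - e ^+ 2 * M) <= 0.
  by rewrite /S in SS; lra.
have d2 : d ^+ 2 <= e ^+ 2.
  by rewrite ler_pXn2r // nnegrE; exact: ltW.
have Mm : M <= m.
  rewrite leNgt; apply/negP => mM.
  have h : d ^+ 2 * m < e ^+ 2 * M.
    apply: le_lt_trans (ler_wpM2r (ltW m0) d2) _.
    by rewrite ltr_pM2l // exprn_gt0.
  have : 0 < (M - m) * (e ^+ 2 * M - d ^+ 2 * m) by rewrite mulr_gt0 // subr_gt0.
  by lra.
have dM : d ^+ 2 * m <= e ^+ 2 * M.
  move: Mm; rewrite le_eqVlt => /orP[/eqP ->|Mm]; first by rewrite ler_wpM2r // ltW.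
  by move: prod; rewrite pmulr_rle0 ?subr_gt0 // subr_le0.
have Am : A <= m.
  rewrite -(ler_pM2r S0); apply: le_trans AS _.
  have : d * M * m <= d * m * m by rewrite ler_pM2r // ler_pM2l.
  by rewrite /S; lra.
by split=> //; lra.
Qed.

(** The inequality of the resolvent against the orbit of 0. *)
Lemma curve_tail (e : R) : 0 < e -> e * sq (u e) <= defect (u e) * (1 + sq (f 0)).
Proof.
move=> e0; have z1 : sq 0 < 1 by rewrite /sq formE.
have := u_rate e0 z1; have m0 := curve_defect_gt0 e0.
rewrite /rate /dcross /cross !formE.
have -> : defect 0 = 1 by rewrite /defect /sq formE subr0.
have := cauchy_schwarz dotE (f 0) (u e); have := sq_ge0 dotE (f 0).
have mE : sq (u e) = 1 - defect (u e) by rewrite /defect; ring.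
have := u1 e0; have := sq_ge0 dotE (u e); rewrite mE.
move: (defect _) (re (f 0) _) (im (f 0) _) (sq (f 0)) m0 => m p q k m0 hm hm' k0 cs h.
have p2 : p ^+ 2 <= k by have := sqr_ge0 q; nra.
have : - p <= 1 + k by nra.
by move=> pk; have := ler_wpM2l (ltW m0) pk; lra.
Qed.

Lemma cvg_rate (T : Type) (G : set_system T) {GG : Filter G} (g : T -> H) z y :
  sq (g t - y) @[t --> G] --> (0 : R) -> rate z (g t) @[t --> G] --> rate z y.
Proof.
move=> gy.
have cst x : sq (x - x) @[t --> G] --> (0 : R).
  by rewrite subrr /sq formE; exact: cvg_cst.
have cz := cst z; have cf := cst (f z).
have wg : weakly dot G g y by exact: strong_weakly.
have rE x : rate z x = (2 * (1 - re z x) * re (f z) x - 2 * im z x * im (f z) x) *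
    (1 - sq z) - ((1 - re z x) * (1 - re z x) + im z x * im z x) * (2 * re (f z) z).
  by rewrite /rate /dcross /cross /defect !formE !addr0 !expr2.
by rewrite rE (eq_fun (fun t => rE (g t))); cvg_form.
Qed.

(** By [curve_compare], e |-> u_e is Cauchy as e decreases to 0, because
    sq (u_e) is monotone and bounded. The term of order e in the resolvent
    inequality disappears in the limit, and a limit inside the ball would be a
    null point by [stationary_of_rate]. *)
Lemma curve_limit : (forall x, ~ null_point f x) ->
  exists tau, [/\ sq tau = 1, sq (u e - tau) @[e --> (0 : R)^'+] --> (0 : R)
    & forall z, sq z < 1 -> rate z tau <= 0].
Proof.
move=> nonull.
pose S := [set sq (u e) | e in [set e : R | 0 < e]].
have hS : has_sup S.
  split; first by exists (sq (u 1)), 1 => /=.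
  by exists 1 => _ [e e0 <-]; rewrite ltW // u1.
have uS (e : R) : 0 < e -> sq (u e) <= sup S by move=> e0; apply: (ub_le_sup hS.2); exists e.
have [tau ul] : exists tau, sq (u e - tau) @[e --> (0 : R)^'+] --> (0 : R).
  apply: sq_complete => // d d0.
  have [_ [e /= e0 <-] he] := sup_adherent d0 hS.
  exists [set t | 0 < t <= e].
    near=> t; apply/andP; split; first by near: t; exact: nbhs_right_gt.
    by apply: ltW; near: t; exact: nbhs_right_lt.
  have key (s t : R) : 0 < s -> s <= t -> t <= e -> sq (u t - u s) < d.
    move=> s0 st te; have t0 := lt_le_trans s0 st.
    have [_ _ h1] := curve_compare s0 st; have [h2 _ _] := curve_compare t0 te.
    by have := uS _ s0; rewrite /defect in h1 h2; lra.
  move=> s t /= /andP[s0 se] /andP[t0 te]; have [st|/ltW ts] := leP s t.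
    by rewrite (sqC _ (u s)) key.
  by rewrite key.
have h0 : (h : R) @[h --> (0 : R)^'+] --> (0 : R).
  by apply: cvg_at_right_filter; exact: cvg_id.
have tau1 : sq tau <= 1.
  rewrite -subr_le0; apply: (@cvg_le0 _ _ (0 : R)^'+ _ (fun e => sq (u e) - 1)).
    by apply: cvgB; [exact: cvg_sq | exact: cvg_cst].
  near=> e; have e0 : 0 < e by near: e; exact: nbhs_right_gt.
  by rewrite subr_le0 ltW // u1.
have trate z : sq z < 1 -> rate z tau <= 0.
  move=> z1; have rl : rate z (u e) @[e --> (0 : R)^'+] --> rate z tau by exact: cvg_rate.
  have cz : sq (z - z) @[_ --> (0 : R)^'+] --> (0 : R).
    by rewrite subrr /sq formE; exact: cvg_cst.
  have wu : weakly dot (0 : R)^'+ u tau by exact: strong_weakly.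
  have M0 : 0 < defect z by rewrite subr_gt0.
  have L : rate z (u e) - 2 * e * defect z * (1 - re z (u e)) @[e --> (0 : R)^'+] -->
     rate z tau - 2 * 0 * defect z * (1 - re z tau).
    by apply: cvgB => //; cvg_form.
  rewrite mulr0 !mul0r subr0 in L; apply: cvg_le0 L _; near=> e.
  have e0 : 0 < e by near: e; exact: nbhs_right_gt.
  have m0 := curve_defect_gt0 e0; rewrite subr_le0 -(ler_pM2r m0).
  apply: le_trans (u_rate e0 z1) _.
  have N0 : 0 <= cross z (u e) by rewrite addr_ge0 // sqr_ge0.
  have : 0 <= 2 * e * defect z * cross z (u e).
    by rewrite !mulr_ge0 // ltW.
  by lra.
exists tau; split=> //; apply/eqP; rewrite eq_le tau1 /= leNgt; apply/negP => lt1.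
have st := stationary_of_rate dotE semigroupF nonexpF genF lt1 trate.
apply: (nonull tau); split; first exact/ballE.
exact: (stationary_null dotE genF lt1 st).
Unshelve. all: by end_near. Qed.

(** Let y = u_e, v = f y and m = 1 - |y|^2. Along the orbit of y, at time s, the
    derivative of [horo y] is at most - 2 e s Re <v, y> / m + o(s), whereas
    horo y (F_t y) - m is t ^ 2 (m |v|^2 + |<v, y>|^2) / m + o(t ^ 2). Hence
    m |v|^2 + |<v, y>|^2 <= - e Re <v, y>, and the maximum of
    - e a - a ^ 2 over a is e ^ 2 / 4. *)
Lemma curve_speed (e : R) : 0 < e -> defect (u e) * sq (f (u e)) <= e ^+ 2 / 4.
Proof.
move=> e0; have m0 := curve_defect_gt0 e0; have u1e := u1 e0.
set y := u e in m0 u1e *; set v := f y; set m := defect y in m0 *.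
suff : m * sq v + re v y ^+ 2 + im v y ^+ 2 <= - e * re v y.
  have := sqr_ge0 (re v y + e / 2); have := sqr_ge0 (im v y).
  by move: (sq v) (re v y) (im v y) => a b c *; nra.
have h0 : (h : R) @[h --> (0 : R)^'+] --> (0 : R).
  by apply: cvg_at_right_filter; exact: cvg_id.
have vl : sq (vel h y - v) @[h --> (0 : R)^'+] --> (0 : R) by exact: vel_cvg.
have Fl : sq (F h y - y) @[h --> (0 : R)^'+] --> (0 : R).
  exact: (flow_right dotE semigroupF).
have cy : sq (y - y) @[_ --> (0 : R)^'+] --> (0 : R).
  by rewrite subrr /sq formE; exact: cvg_cst.
have wy : weakly dot (0 : R)^'+ (fun=> y) y by exact: strong_weakly.
suff key (c : R) : - e * re v y / m < c -> m * sq v + re v y * re v y + im v y * im v y <= c * m.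
  rewrite leNgt !expr2; apply/negP => lt.
  pose c := (m * sq v + re v y * re v y + im v y * im v y - e * re v y) / (2 * m).
  have cE : 2 * (c * m) = m * sq v + re v y * re v y + im v y * im v y - e * re v y.
    by rewrite /c; field; rewrite gt_eqF.
  have : - e * re v y / m < c by rewrite ltr_pdivrMr //; lra.
  by move=> /key; lra.
move=> cgt.
(* the growth rate of horo y along the orbit of y is at most 2 c s for small s *)
have qc : - (2 * e) * ((1 - re (F h y) y) / (m * defect (F h y))) * re (vel h y) y
    @[h --> (0 : R)^'+] --> - (2 * e) * ((1 - re y y) * (m * (1 - sq y))^-1) * re v y.
  have Mi : (m * (1 - sq (F h y)))^-1 @[h --> (0 : R)^'+] --> (m * (1 - sq y))^-1.
    by apply: cvgV; [rewrite mulf_neq0 // gt_eqF | cvg_form].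
  by rewrite /defect; cvg_form.
have lim_lt : - (2 * e) * ((1 - re y y) * (m * (1 - sq y))^-1) * re v y < 2 * c.
  have -> : (1 - re y y) * (m * (1 - sq y))^-1 = m^-1.
    by rewrite -/(sq y) -/(defect y) -/m; field; rewrite gt_eqF.
  have -> : - (2 * e) / m * re v y = 2 * (- e * re v y / m) by ring.
  by rewrite ltr_pM2l.
have [d d0 hd] := near_rightP (cvgr_lt _ qc _ lim_lt).
have grow (t : R) : 0 < t < d -> horo y (F t y) <= m + c * t ^+ 2.
  move=> /andP[t0 td]; have := horo_flow dotE semigroupF nonexpF genF (u := y)
    (b := 0) (c := c) u1e t0.
  rewrite (horo_self u1e) -/m mul0r addr0; apply => s /andP[s0 st].
  move: s0; rewrite le_eqVlt => /orP[/eqP <-|s0].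
    have -> : F 0 y = y by exact: (flow0 dotE semigroupF).
    rewrite mulr0 addr0 mul0r; have := u_rate e0 u1e; rewrite -/y.
    rewrite /cross imxx expr0n addr0 -/(sq y) -/(defect y) -/m.
    by rewrite -expr2 subrr mulr0 pmulr_lle0.
  have Fs1 : sq (F s y) < 1 by apply: (flow_ball dotE semigroupF) => //; exact: ltW.
  have M0 : 0 < defect (F s y) by rewrite subr_gt0.
  have := hd s; rewrite add0r => /(_ _) h.
  have {}h : - (2 * e) * ((1 - re (F s y) y) / (m * defect (F s y))) *
     re (vel s y) y < 2 * c by apply: h; rewrite s0 /= (lt_trans st).
  rewrite add0r -(ler_pM2r m0).
  have := u_rate e0 Fs1; rewrite -/y -/m.
  have AE : 1 - re (F s y) y = m + s * re (vel s y) y.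
    have := flow_vel F y s0; move: (vel s y) => w ->.
    by rewrite !formE /m /defect /sq; ring.
  have AN : (1 - re (F s y) y) ^+ 2 <= cross (F s y) y by rewrite lerDl sqr_ge0.
  move: AE AN h M0; move: (re (vel s y) y) (1 - re _ y) (cross _ _) (defect (F s y)).
  move=> r A N M AE AN h M0 hr.
  apply: le_trans hr _.
  have mM : 0 < m * M by exact: mulr_gt0.
  have {}h : - (2 * e) * A * r <= 2 * c * (m * M).
    move: h; rewrite mulrA mulrAC ltr_pdivrMr // => /ltW; lra.
  have h1 : A * m - N <= - s * (A * r) by rewrite expr2 {1}AE in AN; lra.
  have e2 : 0 < 2 * e * M by rewrite !mulr_gt0.
  apply: le_trans (ler_wpM2l (ltW e2) h1) _.
  by have := ler_wpM2l (ltW (mulr_gt0 s0 M0)) h; lra.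
have L : m * sq (vel h y) + re (vel h y) y * re (vel h y) y +
    im (vel h y) y * im (vel h y) y - c * (1 - sq (F h y)) @[h --> (0 : R)^'+] -->
    m * sq v + re v y * re v y + im v y * im v y - c * (1 - sq y).
  by cvg_form.
rewrite -subr_le0; apply: cvg_le0 L _; near=> h.
have hp : 0 < h by near: h; exact: nbhs_right_gt.
have hd' : h < d by near: h; exact: nbhs_right_lt.
have M0 : 0 < defect (F h y) by rewrite subr_gt0 (flow_ball dotE semigroupF) // ltW.
have := grow h; rewrite hp hd' => /(_ isT); rewrite /horo ler_pdivrMr // => h1.
have h2 : h ^+ 2 * (m * sq (vel h y) + re (vel h y) y * re (vel h y) y +
    im (vel h y) y * im (vel h y) y) = cross (F h y) y - m * defect (F h y).
  have := flow_vel F y hp; move: (vel h y) => w ->.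
  by rewrite /cross /m /defect /sq !formE (re_sym dot y w); ring.
rewrite -(pmulr_rle0 _ (exprn_gt0 2 hp)) mulrBr h2 -/(defect (F h y)).
by lra.
Unshelve. all: by end_near. Qed.

(** By [curve_tail], 1 - |u_e|^2 is at least a multiple of e once |u_e|^2 > 1/2,
    so [curve_speed] gives sq (f (u_e)) = O(e). *)
Lemma curve_null tau : sq tau = 1 -> sq (u e - tau) @[e --> (0 : R)^'+] --> (0 : R) ->
  sq (f (u e)) @[e --> (0 : R)^'+] --> (0 : R).
Proof.
move=> tau1 ul; pose k := (1 + sq (f 0)) / 2.
have k0 : 0 < k by rewrite divr_gt0 // ltr_pwDl // sq_ge0.
have h0 : (h : R) @[h --> (0 : R)^'+] --> (0 : R).
  by apply: cvg_at_right_filter; exact: cvg_id.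
have L : k * e @[e --> (0 : R)^'+] --> k * 0 by cvg_form.
rewrite mulr0 in L; apply: squeeze_cvgr (cvg_cst 0) L.
have half : (2^-1 : R) < sq tau by rewrite tau1 invf_lt1 // ltr1n.
have su := cvgr_gt _ (cvg_sq dotE ul) _ half.
near=> e; have e0 : 0 < e by near: e; exact: nbhs_right_gt.
have he : 2^-1 < sq (u e) by near: e; exact: su.
rewrite sq_ge0 //=; have m0 := curve_defect_gt0 e0.
have := curve_speed e0; have := curve_tail e0.
have -> : 1 + sq (f 0) = 2 * k by rewrite /k; field.
move: (sq (f (u e))) (defect (u e)) (sq (u e)) he m0 => V m s he m0 h1 h2.
have h3 : e / 2 <= m * (2 * k) by apply: le_trans h1; rewrite ler_pM2l // ltW.
rewrite -(ler_pM2l m0); apply: le_trans h2 _.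
by have := ler_wpM2l (ltW e0) h3; lra.
Unshelve. all: by end_near. Qed.

Lemma curve_continuous (e : R) : 0 < e -> sq (u d - u e) @[d --> e] --> (0 : R).
Proof.
move=> e0.
have dl : (d : R) @[d --> e] --> e by exact: cvg_id.
have L1 : 1 - (d * e^-1) * (d * e^-1) @[d --> e] --> 1 - (e * e^-1) * (e * e^-1).
  by cvg_form.
have L2 : 1 - (e * d^-1) * (e * d^-1) @[d --> e] --> 1 - (e * e^-1) * (e * e^-1).
  have di : d^-1 @[d --> e] --> e^-1 by apply: cvgV; rewrite ?gt_eqF.
  by cvg_form.
rewrite divff ?gt_eqF // mulr1 subrr in L1 L2.
have L : `|1 - (d * e^-1) * (d * e^-1)| + `|1 - (e * d^-1) * (e * d^-1)|
    @[d --> e] --> `|0 : R| + `|0 : R|.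
  by apply: cvgD; apply: cvg_norm.
rewrite normr0 addr0 in L.
apply: squeeze_cvgr (cvg_cst 0) L; near=> d.
have d0 : 0 < d by near: d; exact: lt_nbhsr.
have key (a b : R) : 0 < a -> a <= b -> sq (u b - u a) <= 1 - (a * b^-1) * (a * b^-1).
  move=> a0 ab; have b0 := lt_le_trans a0 ab.
  have [h1 h2 h3] := curve_compare a0 ab; apply: le_trans h3 _.
  have mb : defect (u b) <= 1 by rewrite gerBl sq_ge0.
  rewrite -expr2 exprMn exprVn lerBlDr -lerBlDl opprB.
  have := curve_defect_gt0 b0; have := curve_defect_gt0 a0.
  move: h1 h2 mb; move: (defect (u a)) (defect (u b)) => x y h1 h2 h3 x0 y0.
  have h4 : a ^+ 2 / b ^+ 2 * y <= x.
    by rewrite mulrAC ler_pdivrMr ?exprn_gt0 // [leRHS]mulrC.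
  have : a ^+ 2 / b ^+ 2 <= 1.
    rewrite ler_pdivrMr ?exprn_gt0 // mul1r ler_pXn2r // nnegrE; exact: ltW.
  by move: (_ / _) h4 => q; nra.
rewrite sq_ge0 //=; have [de|/ltW ed] := leP d e.
  rewrite sqC; apply: le_trans (key _ _ d0 de) _.
  by apply: le_trans (ler_norm _) _; rewrite lerDl normr_ge0.
apply: le_trans (key _ _ e0 ed) _.
by apply: le_trans (ler_norm _) _; rewrite lerDr normr_ge0.
Unshelve. all: by end_near. Qed.
End ResolventCurve.

(** * Radial limits of the generator *)

Section RadialLimits.
Context (R : realType) (H : completeNormedModType R[i]).
Variable dot : {dot H for Num.conj}.
Hypothesis dotE : norm_from_dot dot.
Variables (F : R -> H -> H) (f : H -> H).
Hypothesis semigroupF : continuous_semigroup F.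
Hypothesis nonexpF : forall t : R, 0 <= t -> rho_nonexpansive dot (F t).
Hypothesis genF : generated_by F f.
Implicit Types (x y z u v w : H) (a b c : R).
Local Notation re := (re dot).
Local Notation im := (im dot).
Local Notation sq := (sq dot).
Local Notation defect := (defect dot).
Local Notation cross := (cross dot).
Local Notation horo := (horo dot).
Local Notation dcross := (dcross dot).
Local Notation rate := (rate dot f).

(** Divide the monotonicity inequality between z and y = r tau by
    1 - |y|^2 = (1 - r) (1 + r); the term 2 Re <f y, y> / (1 - |y|^2) tends to
    - al as r -> 1, and the terms <z, f y> to 0. *)
Lemma boundary_rate tau (al : R) z : sq tau = 1 -> sq z < 1 ->
  sq (f (r%:C *: tau)) @[r --> (1 : R)^'-] --> (0 : R) ->
  re (f (r%:C *: tau)) tau / (r - 1) @[r --> (1 : R)^'-] --> al ->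
  rate z tau <= - al * (cross z tau * defect z).
Proof.
move=> tau1 z1 fl ql.
have rl : (r : R) @[r --> (1 : R)^'-] --> (1 : R).
  by apply: cvg_at_left_filter; exact: cvg_id.
have cst x : sq (x - x) @[_ --> (1 : R)^'-] --> (0 : R).
  by rewrite subrr /sq formE; exact: cvg_cst.
have cz := cst z; have cf := cst (f z).
have wy : weakly dot (1 : R)^'- (fun r => r%:C *: tau) tau.
  apply: strong_weakly => //.
  have -> : (fun r : R => sq (r%:C *: tau - tau)) = (fun r => (r - 1) * (r - 1)).
    by apply/funext => r; move: tau1; rewrite /sq !formE => ->; ring.
  by rewrite -[X in _ --> X](mulr0 (1 - 1)) -[X in _ * X](subrr 1); cvg_form.
have wf : weakly dot (1 : R)^'- (fun r => f (r%:C *: tau)) 0.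
  by apply: strong_weakly => //; under eq_fun do rewrite subr0.
have ri : (1 + r)^-1 @[r --> (1 : R)^'-] --> ((1 + 1)^-1 : R).
  by apply: cvgV; [rewrite gt_eqF | cvg_form].
pose Q r := re (f (r%:C *: tau)) tau / (r - 1).
have {}ql : Q r @[r --> (1 : R)^'-] --> al by exact: ql.
have L : (2 * (1 - re z (r%:C *: tau)) * (re (f z) (r%:C *: tau) + re z (f (r%:C *: tau))) -
   2 * im z (r%:C *: tau) * (im (f z) (r%:C *: tau) + im z (f (r%:C *: tau)))) * (1 - sq z) -
   ((1 - re z (r%:C *: tau)) * (1 - re z (r%:C *: tau)) +
    im z (r%:C *: tau) * im z (r%:C *: tau)) *
   (2 * re (f z) z - (1 - sq z) * (2 * (r * (Q r * (1 + r)^-1))))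
   @[r --> (1 : R)^'-] -->
   (2 * (1 - re z tau) * (re (f z) tau + re z 0) -
   2 * im z tau * (im (f z) tau + im z 0)) * (1 - sq z) -
   ((1 - re z tau) * (1 - re z tau) + im z tau * im z tau) *
   (2 * re (f z) z - (1 - sq z) * (2 * (1 * (al * (1 + 1)^-1)))).
  by cvg_form.
rewrite -subr_le0; apply: le_trans (cvg_le0 L _).
  by rewrite /rate /dcross /cross /defect le_eqVlt; apply/orP; left; apply/eqP; field.
near=> r.
have r0 : 0 < r by near: r; apply: nbhs_left_gt.
have r1 : r < 1 by near: r; apply: nbhs_left_lt.
have y1 : sq (r%:C *: tau) < 1.
  by rewrite sqZ tau1 mulr1 expr_lt1 // ltW.
have M0 : 0 < defect (r%:C *: tau) by rewrite subr_gt0.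
rewrite -(pmulr_lle0 _ M0).
have hp := pair_rate dotE semigroupF nonexpF genF z1 y1.
rewrite -subr_le0 in hp.
apply: le_trans hp; rewrite le_eqVlt; apply/orP; left; apply/eqP.
have dE : defect (r%:C *: tau) = (1 - r) * (1 + r) by rewrite /defect sqZ tau1; ring.
have qE : re (f (r%:C *: tau)) (r%:C *: tau) = - (Q r * r) * (1 - r).
  by rewrite /Q reZr; field; lra.
rewrite dE qE /dcross /cross /defect.
by field; lra.
Unshelve. all: by end_near. Qed.

(** If F_T x = x, then the nonincreasing function s |-> horo tau (F_s x) is
    constant on [0, T], although its derivative is at most - al times its
    positive value. *)
Lemma no_fixpoint tau (al T : R) x : sq tau = 1 -> sq x < 1 -> 0 < al -> 0 < T ->
  (forall z, sq z < 1 -> rate z tau <= - al * (cross z tau * defect z)) ->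
  F T x <> x.
Proof.
move=> tau1 x1 al0 T0 hr Fx.
have cr0 z : sq z < 1 -> 0 < cross z tau by move=> z1; rewrite cross_gt0 ?tau1.
have rate0 z : sq z < 1 -> rate z tau <= 0.
  move=> z1; apply: le_trans (hr z z1) _.
  have M0 : 0 < defect z by rewrite subr_gt0.
  by rewrite mulNr oppr_le0 ltW // !mulr_gt0 // cr0.
have Fs1 s : 0 <= s -> sq (F s x) < 1 by move=> s0; apply: (flow_ball dotE semigroupF).
have mono := horo_flow_mono dotE semigroupF nonexpF genF rate0.
have const s : 0 <= s < T -> horo tau (F s x) = horo tau x.
  move=> /andP[s0 sT]; apply/eqP; rewrite eq_le mono //=.
  have Ts : 0 <= T - s by rewrite subr_ge0 ltW.
  rewrite -{1}Fx -(subrK s T) (flow_add dotE semigroupF) //.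
  by rewrite mono // Fs1.
have D0 : 0 < horo tau x by rewrite divr_gt0 ?cr0 // subr_gt0.
have := horo_flow dotE semigroupF nonexpF genF (u := tau) (b := - al * horo tau x)
  (c := 0) x1 T0.
rewrite Fx mul0r addr0 => h.
have : horo tau x <= horo tau x + - al * horo tau x * T.
  apply: h => s sT; have /andP[s0 _] := sT.
  have M0 : 0 < defect (F s x) by rewrite subr_gt0 Fs1.
  rewrite mulr0 mul0r addr0 -(const s sT); apply: le_trans (hr _ (Fs1 _ s0)) _.
  rewrite le_eqVlt; apply/orP; left; apply/eqP.
  by rewrite /horo; field; rewrite gt_eqF.
have : 0 < al * horo tau x * T by rewrite mulr_gt0 // mulr_gt0.
by lra.
Qed.
End RadialLimits.

(** * Sinks and fixed points of the flow *)

Unset Implicit Arguments.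

Theorem mainTheorem2 (R : realType) (H : completeNormedModType R[i])
    (dot : {dot H for Num.conj}) (dotE : norm_from_dot dot)
    (F : R -> H -> H) (f : H -> H)
    (semigroupF : continuous_semigroup F)
    (nonexpF : forall t : R, 0 <= t -> rho_nonexpansive dot (F t))
    (genF : generated_by F f) :
  [/\ (* "null point free" and "no stationary point" are the same condition *)
      (forall x : H, ~ null_point f x) <-> (forall x : H, ~ stationary_point F x),
      (forall x : H, ~ null_point f x) ->
        let sink (tau : H) :=
          unit_sphere tau /\
          exists2 alpha : R, 0 <= alpha &
            forall (x : H) (t : R), unit_ball x -> 0 <= t ->
              d_ dot tau (F t x) <= expR (- (t * alpha)) * d_ dot tau x in
        exists tau : H,
          [/\ sink tau,
              forall tau' : H, sink tau' -> tau' = tau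
            & exists c : R -> H,
                [/\ {within `[0, 1[, continuous c},
                    forall r : R, 0 <= r < 1 -> unit_ball (c r),
                    c r @[r --> (1 : R)^'-] --> tau
                  & f (c r) @[r --> (1 : R)^'-] --> (0 : H)]]
    & forall (tau : H) (alpha : R),
        unit_sphere tau ->
        f (r%:C *: tau) @[r --> (1 : R)^'-] --> (0 : H) ->
        complex.Re (dot (f (r%:C *: tau)) tau) / (r - 1) @[r --> (1 : R)^'-] --> alpha ->
        0 < alpha ->
        forall t : R, 0 < t -> ~ exists2 x : H, unit_ball x & F t x = x].
Proof.
split.
- split=> nox x [xB hx].
    apply: (nox x); split=> //; apply: (stationary_null dotE genF) => //.
    exact/ballE.
  apply: (nox x); split=> // t t0.
  by apply: (null_stationary dotE semigroupF nonexpF genF) => //; apply/ballE.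
- move=> nonull sink.
  have [u [u1 u_rate u_pair]] := resolvents dotE semigroupF nonexpF genF.
  have [tau [tau1 ul trate]] := curve_limit dotE semigroupF nonexpF genF u1 u_rate u_pair nonull.
  have mono : forall (x : H) (t : R), sq dot x < 1 -> 0 <= t ->
      horo dot tau (F t x) <= horo dot tau x.
    by move=> x t; apply: (horo_flow_mono dotE semigroupF nonexpF genF).
  exists tau; split.
  + split; first exact/sphereE.
    exists 0 => // x t /(ballE dotE) x1 t0.
    by rewrite mulr0 oppr0 expR0 mul1r !(d_E dotE) mono.
  + move=> tau' [/(sphereE dotE) tau1' [al al0 hal]].
    apply/eqP; apply/negP => /negP neq.
    have [p p1 hp] := horoballs_touch dotE tau1' tau1 neq.
    have st t : 0 <= t -> F t p = p.
      move=> t0; have Fp1 : sq dot (F t p) < 1 by apply: (flow_ball dotE semigroupF).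
      apply: hp => //; last exact: mono.
      have := hal p t; rewrite !(d_E dotE) => /(_ _ t0) h.
      apply: le_trans (h _) _; first exact/ballE.
      rewrite ler_piMl //.
        apply: divr_ge0; first by rewrite addr_ge0 ?sqr_ge0.
        by rewrite subr_ge0 ltW.
      by rewrite -[leRHS]expR0 ler_expR oppr_le0 mulr_ge0.
    apply: (nonull p); split; first exact/ballE.
    exact: (stationary_null dotE genF p1 st).
  + exists (fun r => u (1 - r)); split.
    * apply: continuous_in_subspaceT => r /set_mem /=.
      rewrite in_itv /= => /andP[_ r1].
      apply/(cvg_sqP dotE).
      have e0 : 0 < 1 - r by rewrite subr_gt0.
      have := curve_continuous dotE u1 u_pair e0; apply: cvg_comp.
      by apply: cvgB; [exact: cvg_cst | exact: cvg_id].
    * by move=> r /andP[_ r1]; apply/(ballE dotE)/u1; rewrite subr_gt0.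
    * by apply/(cvg_sqP dotE) => A /ul; exact: near_left1.
    * apply/(cvg_sqP dotE).
      have un := curve_null dotE semigroupF nonexpF genF u1 u_rate tau1 ul.
      move=> A /un /near_left1; apply: filterS => r /=.
      by rewrite subr0.
- move=> tau al /(sphereE dotE) tau1 /(cvg_sqP dotE) fl ql al0 t t0.
  move=> [x /(ballE dotE) x1].
  apply: (no_fixpoint dotE semigroupF nonexpF genF tau1 x1 al0 t0) => z z1.
  apply: (boundary_rate dotE semigroupF nonexpF genF tau1 z1 _ ql).
  by move: fl; under eq_fun do rewrite subr0.
Qed.
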